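(* Let $\pi$ be a sum indecomposable permutation of length at least $5$ that is not an increasing oscillation. Then $\pi$ is uniquely determined by its set $K(\pi)$ of sum indecomposable children: if $\tau$ is any sum indecomposable permutation with $K(\tau)=K(\pi)$, then $\tau=\pi$.
   Context: Permutations are written in one-line notation. A permutation $\sigma$ is contained in $\pi$ if $\pi$ has a (not necessarily consecutive) subsequence order isomorphic to $\sigma$. The sum $\alpha\oplus\beta$ of permutations $\alpha$ (length $k$) and $\beta$ (length $\ell$) is the permutation of length $k+\ell$ with $(\alpha\oplus\beta)(i)=\alpha(i)$ for $i\le k$ and $(\alpha\oplus\beta)(i)=\beta(i-k)+k$ for $k<i\le k+\ell$. A nonempty permutation is sum indecomposable if it cannot be written as the sum of two nonempty permutations. For an entry $x$ of $\pi$, $\pi-x$ denotes the permutation order isomorphic to the sequence obtained from $\pi$ by deleting $x$; such a permutation is a child of $\pi$. For a sum indecomposable $\pi$, $K(\pi)=\{\pi-x : x \text{ an entry of } \pi,\ \pi-x \text{ sum indecomposable}\}$. The inversion graph of $\pi$ has the entries of $\pi$ as vertices, with two entries adjacent iff they form an inversion. An increasing oscillation is a permutation whose inversion graph is a path (this includes $1$, $21$, $231$, $312$). *)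

(* Defs.v *)
From mathcomp Require Import all_boot perm.
From mathcomp Require Import classical_sets.

Set Implicit Arguments.
Unset Strict Implicit.
Unset Printing Implicit Defensive.

(* Permutations of all lengths in a single type, since permutations of
   possibly different lengths have to be compared. *)
Definition permutation : Type := {n : nat & 'S_n}.

Definition perm_length (pi : permutation) : nat := tag pi.

Definition entry (pi : permutation) : 'S_(perm_length pi) := tagged pi.

(* 'S_n acts on {0, ..., n-1}, hence the shift to the values 1, ..., n. *)
Definition one_line (pi : permutation) : seq nat :=
  [seq (entry pi i).+1 | i <- enum 'I_(perm_length pi)].

Definition sum_fun k l (a : 'S_k) (b : 'S_l) (i : 'I_(k + l)) : 'I_(k + l) :=
  match split i with
  | inl i1 => lshift l (a i1)
  | inr i2 => rshift k (b i2)
  end.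

Lemma sum_fun_inj k l (a : 'S_k) (b : 'S_l) : injective (sum_fun a b).
Proof.
move=> i j; rewrite /sum_fun; case: (split_ordP i) => i' ->;
  case: (split_ordP j) => j' -> //.
- by move=> /lshift_inj/perm_inj->.
- by move/eqP; rewrite eq_lrshift.
- by move/eqP; rewrite eq_rlshift.
- by move=> /rshift_inj/perm_inj->.
Qed.

Definition perm_sum (alpha beta : permutation) : permutation :=
  Tagged (fun n : nat => 'S_n) (perm (@sum_fun_inj _ _ (entry alpha) (entry beta))).

Definition sum_indecomposable (pi : permutation) : Prop :=
  0 < perm_length pi /\
  forall alpha beta : permutation,
    0 < perm_length alpha -> 0 < perm_length beta -> pi <> perm_sum alpha beta.

Definition order_isomorphic (s t : seq nat) : Prop :=
  size s = size t /\
  forall i j, i < size s -> j < size s ->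
    (nth 0 s i < nth 0 s j) = (nth 0 t i < nth 0 t j).

(* sigma = pi - x; the entries of pi are distinct, so rem deletes exactly the
   entry x. *)
Definition is_deletion (pi : permutation) (x : nat) (sigma : permutation)
    : Prop :=
  x \in one_line pi /\
  order_isomorphic (one_line sigma) (rem x (one_line pi)).

Definition K (pi : permutation) : set permutation :=
  [set sigma | (exists x, is_deletion pi x sigma) /\
               sum_indecomposable sigma]%classic.

(* Entries are represented by their positions. *)
Definition inversion_graph (pi : permutation) : rel 'I_(perm_length pi) :=
  fun i j => (i < j) && (entry pi j < entry pi i)
          || (j < i) && (entry pi i < entry pi j).

Definition is_path_graph (T : finType) (e : rel T) : Prop :=
  0 < #|T| /\
  exists2 v : 'I_#|T| -> T, bijective v &
    forall i j : 'I_#|T|, e (v i) (v j) = (i.+1 == j) || (j.+1 == i).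

Definition increasing_oscillation (pi : permutation) : Prop :=
  is_path_graph (@inversion_graph pi).

(* Main.v *)
(* Let a be the first value of pi and p the position of its minimum.  Deleting
   an entry x other than these two replaces (a, p) by
   (a - [pi(x) < a], p - [x < p]), so an entry of the upper right region Q (above
   a and to the right of p) leaves (a, p) unchanged; if Q is not empty, then some
   entry of Q can be deleted without losing indecomposability.  Compare these
   pairs for pi and tau.  If both regions are nonempty, either the pairs agree or
   they differ by (1, -1) and each permutation minus its first entry or minimum
   is a child of the other by a far deletion; in the latter case pi is shown to
   repeat itself along its inversion graph, which is thus a path.  If pi does not
   start with its maximum or end with its minimum and its region is empty, then
   every entry of pi may be deleted; the pairs agree again when both regions are
   empty, and if only one is, the children of the last entry and of the maximum
   leave a single shape, which is excluded directly.  Once the pairs agree, the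
   first entry or the minimum can be deleted, and its deletion is recognised in
   the other permutation unless it lies in a monotone run at the start, whose
   length is then read off.  If pi starts with its maximum, so does
   tau, and the remaining permutations have the same children, all of them
   connected or not; their first values are compared in the same way. *)

Require Import Defs.
From mathcomp Require Import all_boot perm.
From mathcomp Require Import classical_sets.
From mathcomp Require Import zify.

Set Implicit Arguments.
Unset Strict Implicit.
Unset Printing Implicit Defensive.

(** * Permutations as pairs of inverse functions *)

(** Functions on [nat] rather than on ordinals keep positions and values open to linear arithmetic.
    Carrying the inverse lets [inv] exchange the two, so that each argument also serves its mirror
    image. *)
Record nperm (n : nat) := NPerm {
  fw :> nat -> nat;
  bw : nat -> nat;
  fw_lt : forall i, i < n -> fw i < n;
  bw_lt : forall v, v < n -> bw v < n;
  fwK : forall i, i < n -> bw (fw i) = i;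
  bwK : forall v, v < n -> fw (bw v) = v }.

Definition inv n (f : nperm n) : nperm n :=
  NPerm (bw_lt f) (fw_lt f) (bwK f) (fwK f).

Lemma fw_inj n (f : nperm n) i j : i < n -> j < n -> f i = f j -> i = j.
Proof. by move=> lti ltj eqf; rewrite -(fwK f lti) eqf fwK. Qed.

Lemma fw_neq n (f : nperm n) i j : i < n -> j < n -> i <> j -> f i <> f j.
Proof. by move=> ltin ltjn neq_ij /(fw_inj ltin ltjn). Qed.

Arguments fw_neq {n} f {i j}.

Lemma bw_neq n (f : nperm n) i j : i < n -> j < n -> i <> j -> bw f i <> bw f j.
Proof. exact: (fw_neq (inv f)). Qed.

Arguments bw_neq {n} f {i j}.

Lemma ltn_unbump c u v : u <> c -> v <> c -> (unbump c u < unbump c v) = (u < v).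
Proof. by rewrite /unbump => uc vc; apply/idP/idP; lia. Qed.

Definition eqn_on n (f h : nat -> nat) := forall i, i < n -> f i = h i.

Lemma eqn_on_sym n (f h : nat -> nat) : eqn_on n f h -> eqn_on n h f.
Proof. by move=> E i lti; rewrite E. Qed.

(* The child at position [x]: [bump] and [unbump] renormalise positions and
   values. *)
Definition del (f : nat -> nat) x k := unbump (f x) (f (bump x k)).

Lemma del_lt f x k : k < x -> del f x k = unbump (f x) (f k).
Proof. by rewrite /del /bump => lt_kx; congr (unbump _ (f _)); lia. Qed.

Lemma del_ge f x k : x <= k -> del f x k = unbump (f x) (f k.+1).
Proof. by rewrite /del /bump => le_xk; congr (unbump _ (f _)); lia. Qed.

Lemma del_unbump f x i : i <> x -> del f x (unbump x i) = unbump (f x) (f i).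
Proof. by move=> /eqP/negPf neq; rewrite /del unbumpKcond neq. Qed.

Lemma del_ext m (u v : nat -> nat) z k : eqn_on m u v -> z < m -> k < m.-1 ->
  del u z k = del v z k.
Proof. by move=> E ltz ltk; rewrite /del !E // /bump; lia. Qed.

Section Child.
Variables (n : nat) (f : nperm n) (x : nat).
Hypothesis ltxn : x < n.

Lemma child_fw_lt k : k < n.-1 -> del f x k < n.-1.
Proof.
move=> ltk; have ltb : bump x k < n by rewrite /bump; lia.
have nb : bump x k <> x by rewrite /bump; lia.
have := fw_neq f ltb ltxn nb; have := fw_lt f ltb; have := fw_lt f ltxn.
by rewrite /del /unbump; lia.
Qed.

Lemma child_fwK k : k < n.-1 -> del (bw f) (f x) (del f x k) = k.
Proof.
move=> ltk; have ltb : bump x k < n by rewrite /bump; lia.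
have nb : bump x k <> x by rewrite /bump; lia.
have nf := fw_neq f ltb ltxn nb.
by rewrite {2}/del del_unbump // !fwK // bumpK.
Qed.

End Child.

Definition child n (f : nperm n) x (ltxn : x < n) : nperm n.-1.
refine (@NPerm n.-1 (del f x) (del (bw f) (f x)) _ _ _ _).
- exact: child_fw_lt.
- exact: (child_fw_lt (inv f) (fw_lt f ltxn)).
- exact: child_fwK.
- by move=> v ltv; have := child_fwK (inv f) (fw_lt f ltxn) ltv; rewrite /= fwK.
Defined.

Lemma unbump_unbump a b c : b <> a -> c <> a -> c <> b ->
  unbump (unbump a b) (unbump a c) = unbump (unbump b a) (unbump b c).
Proof. by rewrite /unbump; lia. Qed.

(** Both orders remove the same two entries; the later position moves down once the earlier entry is
    gone. *)
Lemma del_del n (f : nperm n) x z k : z < x -> x < n -> k < n.-2 ->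
  del (del f x) z k = del (del f z) x.-1 k.
Proof.
move=> ltzx ltxn ltk.
have E : bump x (bump z k) = bump z (bump x.-1 k) by rewrite /bump; lia.
have Ex : bump z x.-1 = x by rewrite /bump; lia.
have lti : bump z (bump x.-1 k) < n by rewrite /bump; lia.
have nz : bump z (bump x.-1 k) <> z by rewrite /bump; lia.
have nx : bump z (bump x.-1 k) <> x by rewrite /bump; lia.
have ltzn : z < n by lia.
have nzx : z <> x by lia.
have := fw_neq f lti ltzn nz; have := fw_neq f lti ltxn nx; have := fw_neq f ltzn ltxn nzx.
have Ez : bump x z = z by rewrite /bump; lia.
by rewrite /del E Ex Ez => *; apply: unbump_unbump.
Qed.

(* Sum indecomposability, i.e. connectedness of the inversion graph. *)
Definition conn n (f : nat -> nat) :=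
  all (fun k => has (fun i => k <= f i) (iota 0 k)) (iota 1 n.-1).

Lemma connP n f :
  reflect (forall k, 0 < k < n -> exists2 i, i < k & k <= f i) (conn n f).
Proof.
apply: (iffP allP) => [cf k ltk | cf k].
  have /cf/hasP[i] : k \in iota 1 n.-1 by rewrite mem_iota; lia.
  by rewrite mem_iota => lti lef; exists i => //; lia.
rewrite mem_iota => ltk; have [|i lti lef] := cf k; first lia.
by apply/hasP; exists i; rewrite ?mem_iota //; lia.
Qed.

Lemma closed_conn n f k : conn n f -> 0 < k < n -> ~ (forall i, i < k -> f i < k).
Proof. by move=> /connP cf /cf[i lti lef] /(_ i lti); lia. Qed.

Lemma conn_ext n (f g : nat -> nat) : eqn_on n f g -> conn n f -> conn n g.
Proof.
move=> E /connP cf; apply/connP => k ltk; have [i lti lef] := cf k ltk.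
by exists i => //; rewrite -E //; lia.
Qed.

Lemma nconn n f : ~~ conn n f ->
  exists2 k, 0 < k < n & forall i, i < k -> f i < k.
Proof.
case/allPn=> k; rewrite mem_iota => ltk /hasPn ck; exists k; first lia.
by move=> i lti; have := ck i; rewrite mem_iota; lia.
Qed.

(** Pigeonhole: an injection of the first [k] positions into the first [k] values is onto. *)
Lemma closed_bw n (f : nperm n) k : k <= n -> (forall i, i < k -> f i < k) ->
  forall v, v < k -> bw f v < k.
Proof.
move=> lekn ck v ltv.
have U : uniq (map f (iota 0 k)).
  rewrite map_inj_in_uniq ?iota_uniq // => i j; rewrite !mem_iota => lti ltj eqf.
  by rewrite -[i](fwK f) ?eqf ?fwK //; lia.
have S : {subset map f (iota 0 k) <= iota 0 k}.
  by move=> _ /mapP[i + ->]; rewrite !mem_iota => lti; have := ck i; lia.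
have [|_ E] := uniq_min_size U S; first by rewrite size_map.
have : v \in iota 0 k by rewrite mem_iota.
by rewrite -E => /mapP[i]; rewrite mem_iota => lti ->; rewrite fwK //; lia.
Qed.

Lemma closed_ge n (f : nperm n) k j : k <= j < n -> (forall i, i < k -> f i < k) -> k <= f j.
Proof.
move=> ltj ck; rewrite leqNgt; apply/negP => ltf.
by have := closed_bw (f := f) _ ck ltf; rewrite fwK; lia.
Qed.

Lemma conn_inv n (f : nperm n) : conn n f -> conn n (bw f).
Proof.
move=> cf; apply/negPn/negP => /nconn[k ltk ck]; apply: (closed_conn cf ltk).
by apply: (closed_bw (f := inv f)) => //; lia.
Qed.

(* Position [x] is not a cut vertex of the inversion graph. *)
Definition noncut n (f : nat -> nat) x := conn n.-1 (del f x).

Lemma noncut_inv n (f : nperm n) x : x < n -> noncut n f x -> noncut n (bw f) (f x).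
Proof. by move=> ltx nc; apply: (conn_inv (f := child f ltx)). Qed.

Lemma noncut_bw n (f : nperm n) v : v < n -> noncut n (bw f) v -> noncut n f (bw f v).
Proof. exact: (noncut_inv (f := inv f)). Qed.

(* [A] plays the role of the lower summand of a decomposition. *)
Lemma noncut_intro n (f : nperm n) x : x < n ->
  (forall A : pred nat,
     (forall i j, i < n -> j < n -> i <> x -> j <> x -> A i -> ~~ A j ->
        i < j /\ f i < f j) ->
     forall i j, i < n -> j < n -> i <> x -> j <> x -> A i -> ~~ A j -> False) ->
  noncut n f x.
Proof.
move=> ltx sep; apply/negPn/negP => /nconn[k ltk ck].
have lo y : y < n -> y <> x -> unbump x y < n.-1 by rewrite /unbump; lia.
apply: (sep (fun i => unbump x i < k) _ (bump x 0) (bump x k));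
  rewrite ?bumpK -?leqNgt; try (rewrite /bump; lia).
move=> i j lti ltj nix njx; rewrite -leqNgt => Ai Aj; split; first by rewrite /unbump in Ai Aj; lia.
have := ck _ Ai; rewrite del_unbump // => vi.
have ltj' := lo j ltj njx.
have : k <= del f x (unbump x j).
  by apply: (closed_ge (f := child f ltx)) => //=; lia.
rewrite del_unbump // => vj; have := fw_neq f lti ltx nix; have := fw_neq f ltj ltx njx.
by rewrite /unbump in vi vj *; lia.
Qed.

(** * Coincidences between children *)

Definition same n (f : nat -> nat) x (h : nat -> nat) y :=
  forall k, k < n.-1 -> del f x k = del h y k.

Lemma same_sym n f x h y : same n f x h y -> same n h y f x.
Proof. by move=> S k ltk; rewrite S. Qed.

Lemma same_inv n (f h : nperm n) x y : x < n -> y < n -> same n f x h y ->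
  same n (bw f) (f x) (bw h) (h y).
Proof.
move=> ltx lty S v ltv; have ltd := bw_lt (child f ltx) ltv.
have := bwK (child f ltx) ltv; rewrite /= in ltd * => E.
by rewrite -[v in RHS]E S // child_fwK.
Qed.

Lemma same_first n f x h y : 1 < n -> same n f x h y -> del f x 0 = del h y 0.
Proof. by move=> lt1 -> //; lia. Qed.

Lemma same_zero n (f h : nperm n) x y : 1 < n -> x < n -> y < n -> same n f x h y ->
  del (bw f) (f x) 0 = del (bw h) (h y) 0.
Proof. by move=> lt1 ltx lty /(same_inv ltx lty)/same_first ->. Qed.

Lemma del_zero n (f : nperm n) x : x < n -> 0 < f x ->
  del (bw f) (f x) 0 = unbump x (bw f 0).
Proof. by move=> ltx fx; rewrite del_lt // fwK. Qed.

(** * Monotone runs and cut vertices *)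

Lemma same00_eq n (f h : nperm n) : f 0 = h 0 -> same n f 0 h 0 -> eqn_on n f h.
Proof.
move=> E S [|i] lti //; have lt0 : 0 < n by lia.
have := S i; rewrite !del_ge // E => /(_ ltac:(lia)).
have := fw_neq f lti lt0; have := fw_neq h lti lt0.
by rewrite /unbump; lia.
Qed.

(** For positive [y] the common child starts with the image of [f 1] and with that of [h 0 = f 0];
    renormalising moves a value by at most one. *)
Lemma same_first_adjacent n (f h : nperm n) y : 1 < n -> y < n -> f 0 = h 0 ->
  same n f 0 h y ->
  eqn_on n f h \/ y <> 0 /\ (f 1 = (f 0).+1 \/ f 0 = (f 1).+1).
Proof.
move=> lt1n lty E S; have lt0n : 0 < n by lia.
have [y0|/eqP y0] := eqVneq y 0; first by subst y; left; apply: same00_eq.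
right; split=> //; have := same_first lt1n S.
rewrite del_ge // del_lt; last by lia.
have := fw_neq f lt1n lt0n; have := fw_neq h lty lt0n y0.
by rewrite /unbump -E; lia.
Qed.

(** Deleting any entry of the run of [h] amounts to deleting its first entry. If [y] lies beyond the
    run, the run survives and reappears in [f] at positions 1 to [j], which prolongs the run of
    [f]. *)
Lemma inc_run_step n (f h : nperm n) y j : y < n -> f 0 = h 0 -> 1 < j < n ->
  same n f 0 h y ->
  (forall i, i < j -> f i = f 0 + i) -> (forall i, i < j -> h i = h 0 + i) ->
  eqn_on n f h \/ f j = f 0 + j.
Proof.
move=> lty E ltj S rf rh; have lt0n : 0 < n by lia.
have hout z : j <= z < n -> ~ (h 0 <= h z < h 0 + j).
  move=> ltz hz; have := rh (h z - h 0); have := fw_neq h (i := z) (j := h z - h 0).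
  by lia.
have [ltyj|leyj] := ltnP y j.
  left; apply: same00_eq => // k ltk; rewrite S // [RHS]del_ge // {S}.
  have := rh y; have [ltky|leyk] := ltnP k y.
    by rewrite del_lt //; have := rh k; have := rh k.+1; rewrite /unbump; lia.
  rewrite del_ge //; have := hout k.+1; have := rh k.+1; rewrite /unbump; lia.
right; have := S 0; have := S j.-1; rewrite !(del_ge f) // !(del_lt h); try lia.
rewrite prednK; [|lia].
have := hout y; have := rf 1; have := rh j.-1; have := fw_neq f (i := j) (j := 0).
by rewrite /unbump; lia.
Qed.

Lemma dec_run_step n (f h : nperm n) y j : y < n -> f 0 = h 0 -> 1 < j < n ->
  same n f 0 h y ->
  (forall i, i < j -> f 0 = f i + i) -> (forall i, i < j -> h 0 = h i + i) ->
  eqn_on n f h \/ f 0 = f j + j.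
Proof.
move=> lty E ltj S rf rh; have lt0n : 0 < n by lia.
have hout z : j <= z < n -> ~ (h 0 < h z + j /\ h z <= h 0).
  move=> ltz hz; have := rh (h 0 - h z); have := fw_neq h (i := z) (j := h 0 - h z).
  by lia.
have [ltyj|leyj] := ltnP y j.
  left; apply: same00_eq => // k ltk; rewrite S // [RHS]del_ge // {S}.
  have := rh y; have [ltky|leyk] := ltnP k y.
    by rewrite del_lt //; have := rh k; have := rh k.+1; rewrite /unbump; lia.
  rewrite del_ge //; have := hout k.+1; have := rh k.+1; rewrite /unbump; lia.
right; have := S 0; have := S j.-1; rewrite !(del_ge f) // !(del_lt h); try lia.
rewrite prednK; [|lia].
have := hout y; have := rf 1; have := rh j.-1; have := fw_neq f (i := j) (j := 0).
by rewrite /unbump; lia.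
Qed.

(** The two coincidences prolong the runs of [f] and [h] in turn, until equality is reached or the
    runs fill both permutations. *)
Lemma inc_run_eq n (f h : nperm n) x y : 1 < n -> x < n -> y < n -> f 0 = h 0 ->
  f 1 = (f 0).+1 -> h 1 = (h 0).+1 -> same n f 0 h y -> same n h 0 f x ->
  eqn_on n f h.
Proof.
move=> lt1n ltx lty E f1 h1 Sf Sh.
have run j : 1 < j <= n -> eqn_on n f h \/
    (forall i, i < j -> f i = f 0 + i) /\ (forall i, i < j -> h i = h 0 + i).
  elim: j => // j IH ltj; have [->|/eqP j1] := eqVneq j 1.
    by right; split; case=> [|[]] // *; lia.
  case: IH => [|eq|[rf rh]]; [by lia | by left |].
  have [|eq|eqj] := inc_run_step lty E _ Sf rf rh; [by lia | by left|].
  have [|eq|eqj'] := inc_run_step ltx (esym E) _ Sh rh rf; first by lia.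
    by left=> i /eq.
  right; split=> i; rewrite ltnS leq_eqVlt => /predU1P[->|] //; auto.
case: (run n) => [|//|[rf rh]]; first by lia.
by move=> i lti; rewrite (rf i) // (rh i) // E.
Qed.

Lemma dec_run_eq n (f h : nperm n) x y : 1 < n -> x < n -> y < n -> f 0 = h 0 ->
  f 0 = (f 1).+1 -> h 0 = (h 1).+1 -> same n f 0 h y -> same n h 0 f x ->
  eqn_on n f h.
Proof.
move=> lt1n ltx lty E f1 h1 Sf Sh.
have run j : 1 < j <= n -> eqn_on n f h \/
    (forall i, i < j -> f 0 = f i + i) /\ (forall i, i < j -> h 0 = h i + i).
  elim: j => // j IH ltj; have [->|/eqP j1] := eqVneq j 1.
    by right; split; case=> [|[]] // *; lia.
  case: IH => [|eq|[rf rh]]; [by lia | by left |].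
  have [|eq|eqj] := dec_run_step lty E _ Sf rf rh; [by lia | by left|].
  have [|eq|eqj'] := dec_run_step ltx (esym E) _ Sh rh rf; first by lia.
    by left=> i /eq.
  right; split=> i; rewrite ltnS leq_eqVlt => /predU1P[->|] //; auto.
case: (run n) => [|//|[rf rh]]; first by lia.
by move=> i lti; have := rf i lti; have := rh i lti; lia.
Qed.

(** * Cut vertices among the extreme entries *)

Lemma cut_first n (f : nperm n) : conn n f -> ~~ noncut n f 0 ->
  exists k, [/\ 0 < k < n.-1, k <= f 0, forall i, 0 < i <= k -> f i < k &
    forall v, v < k -> bw f v <= k].
Proof.
move=> cf /nconn[k ltk ck]; have lt0n : 0 < n by lia.
have le_k : k <= f 0.
  rewrite leqNgt; apply/negP => ltf; apply: (closed_conn (k := k.+1) cf); first lia.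
  move=> [|i] lti; first by lia.
  by have := ck i; rewrite del_ge // /unbump; lia.
exists k; split=> //.
  move=> [|i] lti //; have := ck i; rewrite del_ge // /unbump.
  by have := fw_neq f (i := i.+1) (j := 0); lia.
move=> v ltv; have := closed_bw (f := child f lt0n) _ ck ltv.
rewrite /= del_lt; last by lia.
by rewrite fwK // /unbump; lia.
Qed.

(** The second value lies in the block cut off, below [k]. If [f 0] were its successor, then
    [f 0 = k] and the first [k.+1] positions would be closed. *)
Lemma cut_first_second n (f : nperm n) : conn n f -> ~~ noncut n f 0 -> (f 1).+1 < f 0.
Proof.
move=> cf /(cut_first cf)[k [ltk lek ck _]].
have [|E] : (f 1).+1 < f 0 \/ f 0 = k by have := ck 1; lia.
  by [].
case: (closed_conn (k := k.+1) cf); first lia.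
by move=> [|i] lti; [lia | have := ck i.+1; lia].
Qed.

Lemma cut_last n (f : nperm n) : conn n f -> 1 < n -> ~~ noncut n f n.-1 ->
  exists k, [/\ 0 < k, k < n.-1, f n.-1 < k & forall i, i < k -> f i <= k].
Proof.
move=> cf lt1n /nconn[k ltk ck].
have ltf : f n.-1 < k.
  rewrite ltnNge; apply/negP => le_k; apply: (closed_conn (k := k) cf); first lia.
  move=> i lti; have := ck i lti; rewrite del_lt /unbump; last by lia.
  by have := fw_neq f (i := i) (j := n.-1); lia.
exists k; split=> //; try lia.
by move=> i lti; have := ck i lti; rewrite del_lt /unbump; lia.
Qed.

(** If both were cut vertices, their blocks would give [l <= bw f 0 <= k <= f 0 <= l]; all are then
    equal and the first [k.+1] positions are closed. *)
Lemma first_or_bottom n (f : nperm n) : conn n f -> 0 < n ->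
  noncut n f 0 \/ noncut n f (bw f 0).
Proof.
move=> cf lt0n; have [|cutL] := boolP (noncut n f 0); [by left | right].
apply: noncut_bw => //; apply/negPn/negP => cutB.
have [k [ltk lek ck bk]] := cut_first cf cutL.
have [l [ltl lel _ bl]] := cut_first (f := inv f) (conn_inv cf) cutB.
rewrite /= in lel bl.
apply: (closed_conn (k := k.+1) cf); first lia.
have := bl 0; have := bk 0.
by move=> ? ? [|i] lti; [lia | have := ck i.+1; lia].
Qed.

(** If both were cut vertices, then [k <= bw f n.-1 < l] and [l <= f n.-1 < k]. *)
Lemma last_or_top n (f : nperm n) : conn n f -> 1 < n ->
  noncut n f n.-1 \/ noncut n f (bw f n.-1).
Proof.
move=> cf lt1n; have [|cutR] := boolP (noncut n f n.-1); [by left | right].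
apply: noncut_bw; first by lia.
apply/negPn/negP => cutT.
have [k [k0 ltk ltfk ck]] := cut_last cf lt1n cutR.
have [l [l0 ltl ltfl cl]] := cut_last (f := inv f) (conn_inv cf) lt1n cutT.
rewrite /= in ltfl cl.
have := cl (f n.-1); rewrite fwK; last by lia.
have := ck (bw f n.-1); rewrite bwK; last by lia.
lia.
Qed.

(* The first and the last entry then dominate all others in the inversion
   graph. *)
Lemma noncut_last_lt_first n (f : nperm n) x : x < n -> f n.-1 < f 0 ->
  x <> 0 -> x <> n.-1 -> noncut n f x.
Proof.
move=> ltx ltf x0 xl; apply: noncut_intro => // A sep i j lti ltj nix njx Ai Aj.
have A0 : A 0 by apply/negPn/negP => nA0; case: (sep i 0); lia.
have Al : A n.-1 by apply/negPn/negP => nAl; case: (sep 0 n.-1); lia.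
by case: (sep n.-1 j); lia.
Qed.

Lemma noncut_top_before_bottom n (f : nperm n) x : x < n -> bw f n.-1 < bw f 0 ->
  f x <> 0 -> f x <> n.-1 -> noncut n f x.
Proof.
move=> ltx ltf x0 xl; rewrite -(fwK f ltx); apply: noncut_bw; first exact: fw_lt.
by apply: (noncut_last_lt_first (f := inv f)) => //; exact: fw_lt.
Qed.

(* The entries that are neither the first entry nor the minimum and form an
   inversion with neither: deleting one of them changes neither the first value
   nor the position of the minimum. *)
Definition upper_right n (f : nperm n) z := (z < n) && (bw f 0 < z) && (f 0 < f z).

(** If the last entry is below the first or the maximum precedes the minimum, [z] itself can be
    deleted. Otherwise the last entry and the maximum lie in the region, and one of them is no cut
    vertex. *)
Lemma noncut_upper_right n (f : nperm n) z : conn n f -> upper_right f z ->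
  exists2 y, upper_right f y & noncut n f y.
Proof.
move=> cf /andP[/andP[ltzn ltz] ltfz]; have lt1n : 1 < n by lia.
have := fw_lt f ltzn => ltfn; have := bw_lt f (v := n.-1) => ltt.
have := bwK f (v := n.-1) => fT.
have [ltr|ler] := ltnP (f n.-1) (f 0).
  exists z; first by rewrite /upper_right; lia.
  by apply: noncut_last_lt_first => //; [lia | move=> E; rewrite E in ltfz; lia].
have [ltp|lep] := ltnP (bw f n.-1) (bw f 0).
  exists z; first by rewrite /upper_right; lia.
  apply: noncut_top_before_bottom => //; first by lia.
  by move=> E; have := fwK f ltzn; rewrite E; lia.
have := fw_neq f (i := n.-1) (j := 0); have := bw_neq f (i := n.-1) (j := 0).
move=> nb nf; case: (last_or_top cf lt1n) => nc.
  by exists n.-1 => //; rewrite /upper_right; lia.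
by exists (bw f n.-1) => //; rewrite /upper_right fT; lia.
Qed.

(** * First value and position of the minimum *)

(** One inclusion between the two sets of indecomposable children. *)
Definition covers n (f h : nat -> nat) := forall x, x < n -> noncut n f x ->
  exists y, [/\ y < n, noncut n h y & same n f x h y].

Lemma covers_inv n (f h : nperm n) : covers n f h -> covers n (bw f) (bw h).
Proof.
move=> c v ltv ncv; have [] := c (bw f v); [exact: bw_lt | exact: noncut_bw |].
move=> y [lty ncy S]; exists (h y); split; [exact: fw_lt | exact: noncut_inv |].
by have := same_inv (bw_lt f ltv) lty S; rewrite bwK.
Qed.

Lemma eqn_on_bw n (f h : nperm n) : eqn_on n (bw f) (bw h) -> eqn_on n f h.
Proof.
move=> E i lti; have := E (f i) (fw_lt f lti); rewrite fwK // => e.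
by rewrite [in RHS]e bwK //; exact: fw_lt.
Qed.

Lemma del_firstE n (f : nperm n) x : x < n ->
  x = 0 /\ f x = f 0 /\ del f x 0 = f 1 - (f 0 < f 1) \/
  0 < x /\ f x < f 0 /\ del f x 0 = (f 0).-1 \/
  0 < x /\ f 0 < f x /\ del f x 0 = f 0.
Proof.
case: x => [|x] ltx; first by left; rewrite del_ge.
right; have := fw_neq f (i := x.+1) (j := 0); rewrite del_lt //.
by rewrite /unbump; case: ltngtP => /=; lia.
Qed.

Lemma del_secondE n (f : nperm n) x : x < n ->
  x <= 1 /\ del f x 1 = f 2 - (f x < f 2) \/
  1 < x /\ f x < f 1 /\ del f x 1 = (f 1).-1 \/
  1 < x /\ f 1 < f x /\ del f x 1 = f 1.
Proof.
move=> ltx; have [le|gt] := leqP x 1; first by left; rewrite del_ge.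
right; have := fw_neq f (i := x) (j := 1); rewrite del_lt //.
by rewrite /unbump; case: ltngtP => /=; lia.
Qed.

Lemma del_zeroE n (f : nperm n) x : x < n ->
  x = bw f 0 /\ f x = 0 /\
    del (bw f) (f x) 0 = bw f 1 - (bw f 0 < bw f 1) \/
  0 < f x /\ x < bw f 0 /\ del (bw f) (f x) 0 = (bw f 0).-1 \/
  0 < f x /\ bw f 0 < x /\ del (bw f) (f x) 0 = bw f 0.
Proof.
move=> ltx; have := del_firstE (inv f) (fw_lt f ltx); rewrite /= fwK //.
case=> [[fx [_ e]]|c]; [left; split | by right] => //.
by rewrite -fx fwK.
Qed.

(** These tactics split a deletion by its effect on the first value, the second value or the
    position of the minimum; arithmetic discards the cases that contradict the context. *)
Ltac first_cases f ltx := case: (del_firstE f ltx) => [[? [? ?]]|[[? [? ?]]|[? [? ?]]]]; try lia.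
Ltac second_cases f ltx := case: (del_secondE f ltx) => [[? ?]|[[? [? ?]]|[? [? ?]]]]; try lia.
Ltac zero_cases f ltx := case: (del_zeroE f ltx) => [[? [? ?]]|[[? [? ?]]|[? [? ?]]]]; try lia.

Lemma covers_stats n (f h : nperm n) x : 2 < n -> covers n f h -> x < n -> noncut n f x ->
  exists y, [/\ y < n, same n f x h y, del f x 0 = del h y 0, del f x 1 = del h y 1 &
    del (bw f) (f x) 0 = del (bw h) (h y) 0].
Proof.
move=> lt2n c ltx ncx; have [y [lty _ S]] := c x ltx ncx; exists y; split=> //.
- by apply: S; lia.
- by apply: S; lia.
- by apply: same_zero S; lia.
Qed.

Lemma corner_pos n (f : nperm n) : conn n f -> 1 < n ->
  [/\ 0 < f 0, 0 < bw f 0, f 0 < n, bw f 0 < n & f (bw f 0) = 0].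
Proof.
move=> cf lt1n; have lt0n : 0 < n by lia.
have [i] := connP n f cf 1 ltac:(lia); rewrite ltnS leqn0 => /eqP-> f0.
have fb := bwK f lt0n; split=> //; [|exact: fw_lt | exact: bw_lt].
by case: (bw f 0) fb f0 => // ->.
Qed.

Lemma upper_right_inv n (f : nperm n) z : upper_right f z -> upper_right (inv f) (f z).
Proof.
case/andP=> /andP[ltz ltbz] ltf.
by rewrite /upper_right /= fwK // fw_lt // ltf ltbz.
Qed.

(** The child at [z] still starts with [f 0] and its successor, while no single deletion turns the
    initial descent of [h] into that start. *)
Lemma opposite_runs_absurd n (f h : nperm n) z : 2 < n -> conn n f -> covers n f h ->
  f 0 = h 0 -> f 1 = (f 0).+1 -> h 0 = (h 1).+1 -> upper_right f z -> noncut n f z ->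
  False.
Proof.
move=> lt2n cf c E f1 h1 /andP[/andP[ltz ltbz] ltfz] ncz.
have [f00 b00 _ _ _] := corner_pos cf ltac:(lia).
have [y [lty _ e0 e1 _]] := covers_stats lt2n c ltz ncz.
first_cases f ltz; second_cases f ltz.
have : y = 1 -> h y = h 1 by move->.
by first_cases h lty; second_cases h lty.
Qed.

Lemma equal_corner_first n (f h : nperm n) z z' : 2 < n -> conn n f -> conn n h ->
  covers n f h -> covers n h f -> f 0 = h 0 -> bw f 0 = bw h 0 ->
  upper_right f z -> noncut n f z -> upper_right h z' -> noncut n h z' ->
  noncut n f 0 -> eqn_on n f h.
Proof.
move=> lt2n cf ch cfh chf Ea Ep Dz ncz Dz' ncz' nc0; have lt0n : 0 < n by lia.
have lt1n : 1 < n by lia.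
have [y [lty _ S]] := cfh 0 lt0n nc0.
have [//|[y0 adjf]] := same_first_adjacent lt1n lty Ea S.
have [nch|cuth] := boolP (noncut n h 0).
  have [x [ltx _ S']] := chf 0 lt0n nch.
  have [eqhf|[x0 adjh]] := same_first_adjacent lt1n ltx (esym Ea) S'.
    by move=> i lti; rewrite eqhf.
  case: adjf adjh => [f1|f1] [h1|h1].
  - exact: (inc_run_eq (x := x) (y := y)).
  - by case: (opposite_runs_absurd lt2n cf cfh Ea f1 h1 Dz ncz).
  - by case: (opposite_runs_absurd lt2n ch chf (esym Ea) h1 f1 Dz' ncz').
  - exact: (dec_run_eq (x := x) (y := y)).
(* Now [h] starts with a drop of at least two, which the child at [z'] keeps together with the pair.
   A child of [f] with that pair starts with no such drop, as [f 1] is next to [f 0]. *)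
have := cut_first_second ch cuth.
have [h00 q00 _ _ _] := corner_pos ch lt1n.
case/andP: Dz' => /andP[ltz' ltbz'] lthz'.
have [x [ltx _ e0 e1 e2]] := covers_stats lt2n chf ltz' ncz'.
first_cases h ltz'; second_cases h ltz'; zero_cases h ltz'.
by zero_cases f ltx; first_cases f ltx; second_cases f ltx.
Qed.

Lemma equal_corner n (f h : nperm n) z z' : 2 < n -> conn n f -> conn n h ->
  covers n f h -> covers n h f -> f 0 = h 0 -> bw f 0 = bw h 0 ->
  upper_right f z -> upper_right h z' -> eqn_on n f h.
Proof.
move=> lt2n cf ch cfh chf Ea Ep Dz Dz'; have lt0n : 0 < n by lia.
have [{Dz}z Dz ncz] := noncut_upper_right cf Dz.
have [{Dz'}z' Dz' ncz'] := noncut_upper_right ch Dz'.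
have [ltz ltz'] : z < n /\ z' < n by case/andP: Dz Dz' => /andP[? _] _ /andP[/andP[]].
case: (first_or_bottom cf lt0n) => nc0.
  exact: (equal_corner_first (z := z) (z' := z')).
(* Taking inverses turns the minimum into the first entry. *)
apply: eqn_on_bw.
apply: (@equal_corner_first n (inv f) (inv h) (f z) (h z')) => //;
  try exact: conn_inv; try exact: covers_inv; try exact: upper_right_inv;
  try exact: noncut_inv.
by have := noncut_inv (bw_lt f lt0n) nc0; rewrite bwK.
Qed.

(** * Empty upper right regions *)

Definition no_upper_right n (f : nperm n) := forall z, ~~ upper_right f z.

Lemma no_upper_right_inv n (f : nperm n) : no_upper_right f -> no_upper_right (inv f).
Proof. by move=> nf z; apply/negP => /upper_right_inv; apply/negP/nf. Qed.

Lemma no_upper_right_lt n (f : nperm n) i : no_upper_right f -> bw f 0 < i < n -> f i < f 0.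
Proof.
move=> nf lti; have := nf i; have := fw_neq f (i := i) (j := 0).
by rewrite /upper_right; lia.
Qed.

(** The first and last entries dominate the inversion graph, and so do the maximum and the minimum.
    These two pairs are disjoint, so every entry lies outside one of them. *)
Lemma no_upper_right_all_noncut n (f : nperm n) x : conn n f -> 1 < n -> no_upper_right f ->
  f 0 < n.-1 -> bw f 0 < n.-1 -> x < n -> noncut n f x.
Proof.
move=> cf lt1n nf lta ltp ltx; have [a0 p0 _ _ fp] := corner_pos cf lt1n.
have ltr := no_upper_right_lt (i := n.-1) nf ltac:(lia).
have ltt := no_upper_right_lt (i := n.-1) (no_upper_right_inv nf) ltac:(rewrite /=; lia).
rewrite /= in ltt; have ft := bwK f (v := n.-1) ltac:(lia).
have [x0|/eqP x0] := eqVneq x 0.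
  by apply: noncut_top_before_bottom => //; rewrite x0; lia.
have [xl|/eqP xl] := eqVneq x n.-1; last exact: noncut_last_lt_first.
apply: noncut_top_before_bottom => //; rewrite xl; last by lia.
by move=> r0; have := fwK f (i := n.-1); rewrite r0; lia.
Qed.

Section NoUpperRight.
Variables (n : nat) (f h : nperm n).
Hypotheses (lt2n : 2 < n) (cf : conn n f) (ch : conn n h).
Hypotheses (cfh : covers n f h) (chf : covers n h f).
Hypotheses (nf : no_upper_right f) (lta : f 0 < n.-1) (ltp : bw f 0 < n.-1).
Hypotheses (nh : no_upper_right h) (ltb : h 0 < n.-1) (ltq : bw h 0 < n.-1).

Lemma no_upper_right_first_ge : h 0 <= f 0.
Proof.
rewrite leqNgt; apply/negP => ltab; have lt1n : 1 < n by lia.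
have [a0 p0 _ _ fp] := corner_pos cf lt1n; have [b0 q0 _ _ hq] := corner_pos ch lt1n.
have nc y : y < n -> noncut n h y by apply: no_upper_right_all_noncut.
have ltr := no_upper_right_lt (i := n.-1) nh ltac:(lia).
have ltt := no_upper_right_lt (i := n.-1) (no_upper_right_inv nh) ltac:(rewrite /=; lia).
have ltT : bw h n.-1 < n by apply: bw_lt; lia.
have hT := bwK h (v := n.-1) ltac:(lia); rewrite /= in ltt.
(* Without its maximum [h] has the pair [(h 0, (bw h 0).-1)]; a first value above [f 0] arises in
   [f] only by deleting the first entry. *)
have eqp : bw h 0 = bw f 0.
  have [x [ltx _ e0 _ e2]] := covers_stats lt2n chf ltT (nc _ ltT).
  move: ltT ltt hT e0 e2; set t := bw h n.-1 => ltT ltt hT e0 e2.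
  first_cases h ltT; zero_cases h ltT; first_cases f ltx; zero_cases f ltx.
(* Without its last entry [h] has the pair [((h 0).-1, bw h 0)], which [f] could match only by
   deleting an upper right entry. *)
have ltl : n.-1 < n by lia.
have [x [ltx _ e0 _ e2]] := covers_stats lt2n chf ltl (nc _ ltl).
have nx : bw f 0 < x -> f x < f 0 by move=> ?; apply: no_upper_right_lt; rewrite ?ltx ?andbT.
clear ltt ltT hT.
first_cases h ltl; zero_cases h ltl; first_cases f ltx; zero_cases f ltx.
Qed.

(** Without its last entry [f] starts with [(f 0).-1], [f 0] and keeps the position of its minimum.
    In [h] that start requires deleting one of the first two entries, which moves the minimum. *)
Lemma no_upper_right_opposite_runs : f 0 = h 0 -> bw f 0 = bw h 0 ->
  f 1 = (f 0).+1 -> h 0 = (h 1).+1 -> False.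
Proof.
move=> eqa eqp f1 h1; have lt1n : 1 < n by lia.
have [a0 p0 _ _ fp] := corner_pos cf lt1n; have [b0 q0 _ _ hq] := corner_pos ch lt1n.
have ltl : n.-1 < n by lia.
have ncl : noncut n f n.-1 by apply: no_upper_right_all_noncut.
have ltr := no_upper_right_lt (i := n.-1) nf ltac:(lia).
have [y [lty _ e0 e1 e2]] := covers_stats lt2n cfh ltl ncl.
have q1 : bw h 0 != 1.
  apply/eqP => q1; rewrite q1 in hq; apply: (closed_conn (k := 2) ch); first by lia.
  by case=> [|[]] //; lia.
first_cases f ltl; second_cases f ltl; zero_cases f ltl.
have : y = 1 -> h y = h 1 by move->.
by first_cases h lty; second_cases h lty; zero_cases h lty.
Qed.

End NoUpperRight.

Lemma no_upper_right_eq n (f h : nperm n) : 2 < n -> conn n f -> conn n h ->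
  covers n f h -> covers n h f ->
  no_upper_right f -> f 0 < n.-1 -> bw f 0 < n.-1 ->
  no_upper_right h -> h 0 < n.-1 -> bw h 0 < n.-1 -> eqn_on n f h.
Proof.
move=> lt2n cf ch cfh chf nf lta ltp nh ltb ltq; have lt1n : 1 < n by lia.
have eqa : f 0 = h 0.
  by apply/eqP; rewrite eqn_leq !no_upper_right_first_ge.
have [cfi chi] := (conn_inv cf, conn_inv ch).
have [cfhi chfi] := (covers_inv cfh, covers_inv chf).
have [nfi nhi] := (no_upper_right_inv nf, no_upper_right_inv nh).
have eqp : bw f 0 = bw h 0.
  by apply/eqP; rewrite eqn_leq (@no_upper_right_first_ge n (inv f) (inv h)) //
    (@no_upper_right_first_ge n (inv h) (inv f)).
have lt0n : 0 < n by lia.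
have [y [lty _ S]] := cfh 0 lt0n ltac:(exact: no_upper_right_all_noncut).
have [x [ltx _ S']] := chf 0 lt0n ltac:(exact: no_upper_right_all_noncut).
have [//|[_ adjf]] := same_first_adjacent lt1n lty eqa S.
have [eqhf|[_ adjh]] := same_first_adjacent lt1n ltx (esym eqa) S'.
  by move=> i lti; rewrite eqhf.
case: adjf adjh => [f1|f1] [h1|h1].
- exact: (inc_run_eq (x := x) (y := y)).
- by case: (@no_upper_right_opposite_runs n f h).
- by case: (@no_upper_right_opposite_runs n h f).
- exact: (dec_run_eq (x := x) (y := y)).
Qed.

(** * One empty upper right region *)

Lemma noncut_corner_intro n (f : nperm n) x : conn n f -> 1 < n -> x < n ->
  x <> 0 -> x <> bw f 0 ->
  (forall A : pred nat,
     (forall i j, i < n -> j < n -> i <> x -> j <> x -> A i -> ~~ A j ->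
        i < j /\ f i < f j) ->
     (forall j, j < n -> j <> x -> j <= bw f 0 \/ f j <= f 0 -> A j) ->
     forall j, j <> x -> upper_right f j -> A j) ->
  noncut n f x.
Proof.
move=> cf lt1n ltx x0 xp H; have [a0 p0 lta ltp fp] := corner_pos cf lt1n.
apply: noncut_intro => // A sep i j lti ltj nix njx Ai; apply/negP/negPn.
have lt0n : 0 < n by lia.
have A0 : A 0.
  by apply/negPn/negP => nA; case: (sep i 0 lti lt0n nix (not_eq_sym x0) Ai nA).
have Ap : A (bw f 0).
  apply/negPn/negP => nA.
  by case: (sep _ _ lt0n ltp (not_eq_sym x0) (not_eq_sym xp) A0 nA); rewrite fp.
have Aj' k : k < n -> k <> x -> k <= bw f 0 \/ f k <= f 0 -> A k.
  move=> ltk nkx le; apply/negPn/negP => nA.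
  have := sep _ _ ltp ltk (not_eq_sym xp) nkx Ap nA.
  have := sep _ _ lt0n ltk (not_eq_sym x0) nkx A0 nA.
  by clear -le; lia.
have [ur|nur] := boolP (upper_right f j); first exact: H.
by apply: Aj' => //; clear -nur ltj; rewrite /upper_right in nur; lia.
Qed.

Section OneUpperRight.
Variables (n : nat) (f h : nperm n).
Hypotheses (lt4n : 4 < n) (cf : conn n f) (ch : conn n h).
Hypotheses (cfh : covers n f h) (chf : covers n h f).
Hypotheses (nf : no_upper_right f) (lta : f 0 < n.-1) (ltp : bw f 0 < n.-1).
Hypotheses (ltb : h 0 < n.-1) (ltq : bw h 0 < n.-1).

(** The children force [f] to start with [n.-2], [n.-1], 0, 1 and [h] with [n.-2], 0, [n.-1], 1;
    then the child of [h] without its last entry is no child of [f]. *)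
Lemma upper_right_shifted_absurd : f 0 = h 0 -> bw f 0 = (bw h 0).+1 -> False.
Proof.
move=> eqa eqp; have lt2n : 2 < n by lia.
have lt1n : 1 < n by lia.
have [a0 p0 _ _ fp] := corner_pos cf lt1n; have [b0 q0 _ _ hq] := corner_pos ch lt1n.
have nc x : x < n -> noncut n f x by apply: no_upper_right_all_noncut.
have ltl : n.-1 < n by lia.
have ltr := no_upper_right_lt (i := n.-1) nf ltac:(lia).
(* Only deleting the minimum of [h] can move its minimum to the right. *)
have [h1 Sq] : bw h 1 = (bw h 0).+2 /\ same n f n.-1 h (bw h 0).
  have [y [lty S e0 _ e2]] := covers_stats lt2n cfh ltl (nc _ ltl).
  have [ey e] : y = bw h 0 /\ del (bw h) (h y) 0 = (bw h 0).+1.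
    by first_cases f ltl; zero_cases f ltl; zero_cases h lty.
  rewrite ey in S e; split=> //; move: e; rewrite hq del_ge // /unbump.
  by lia.
have ltq2 : (bw h 0).+2 < n by rewrite -h1 bw_lt.
have hq2 : h (bw h 0).+2 = 1 by rewrite -h1 bwK.
have lt1b : 1 < h 0.
  by rewrite ltn_neqAle b0 andbT; apply/eqP => e; have := fw_neq h (i := 0) (j := (bw h 0).+2); lia.
have ur j : upper_right h j -> j = (bw h 0).+1.
  case/andP=> /andP[ltj ltqj] ltbj; apply/eqP; rewrite eqn_leq ltqj andbT leqNgt.
  apply/negP => ltj2; have [e|/eqP ne] := eqVneq j (bw h 0).+2; first by rewrite e hq2 in ltbj; lia.
  have := Sq j.-1 ltac:(lia); rewrite del_lt; last by lia.
  rewrite del_ge; last by lia.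
  have := no_upper_right_lt (i := j.-1) nf ltac:(lia).
  by rewrite (_ : j.-1.+1 = j) ?hq /unbump; lia.
(* The only candidate in the region of [h] is inverted with the value 1 right after it. *)
have nch x : x < n -> x <> 0 -> x <> bw h 0 -> x <> (bw h 0).+2 -> noncut n h x.
  move=> ltx x0 xq xq2; apply: noncut_corner_intro => // A sep A1 j njx urj.
  apply/negPn/negP => nAj; have ej := ur j urj; case/andP: urj => /andP[ltj _] _.
  have A2 : A (bw h 0).+2 by apply: A1; lia.
  case: (sep _ _ ltq2 ltj (not_eq_sym xq2) njx A2 nAj).
  by rewrite ej ltnNge leqnSn.
have ltT : bw f n.-1 < n by exact: bw_lt.
have fT : f (bw f n.-1) = n.-1 by exact: bwK.
have ltTp : bw f n.-1 < bw f 0.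
  have := no_upper_right_lt (i := n.-1) (no_upper_right_inv nf); rewrite /=; lia.
have ST : same n f (bw f n.-1) h (bw h 0).+1.
  have [y [lty S e0 _ e2]] := covers_stats lt2n cfh ltT (nc _ ltT).
  suff ey : upper_right h y by rewrite -(ur y ey).
  rewrite /upper_right lty; clear S; move: ltTp ltT fT e0 e2; set t := bw f n.-1 => ltTp ltT fT e0 e2.
  by first_cases f ltT; zero_cases f ltT; first_cases h lty; zero_cases h lty.
(* Any other entry above [h 0] would stand left of the minimum, and deleting it would put the
   minimum two places before that of [f]. *)
have above i : i < n -> h 0 < h i -> i = (bw h 0).+1.
  move=> lti ltbi; apply: ur; rewrite /upper_right lti ltbi andbT /= ltnNge; apply/negP => leiq.
  have ltiq : i < bw h 0.
    by rewrite ltn_neqAle leiq andbT; apply/eqP => e; rewrite e in ltbi; lia.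
  have [|x [ltx _ e0 _ e2]] := covers_stats lt2n chf lti.
    by apply: nch => //; [move=> i0; rewrite i0 in ltbi | |]; lia.
  by zero_cases h lti; first_cases h lti; zero_cases f ltx; first_cases f ltx.
have eb : h 0 = n.-2.
  have := above (bw h n.-1) ltac:(exact: bw_lt); rewrite bwK // => /(_ ltb) e1.
  have : ~ h 0 < n.-2.
    move=> lt; have := above (bw h n.-2); rewrite bwK; last by lia.
    have := bw_neq h (i := n.-1) (j := n.-2); have := bw_lt h (v := n.-2); lia.
  by lia.
have hz : h (bw h 0).+1 = n.-1.
  by rewrite -(above (bw h n.-1)) ?bwK //; exact: bw_lt.
have fp1 : f (bw f 0).+1 = 1.
  have := ST (bw h 0).+1 ltac:(lia); rewrite !del_ge //; last by lia.
  by rewrite eqp hq2 hz fT /unbump; have := fw_lt f (i := (bw h 0).+2); lia.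
have bf1 : bw f 1 = (bw f 0).+1 by rewrite -fp1 fwK //; lia.
have q1 : bw h 0 = 1.
  apply/eqP; rewrite eqn_leq q0 andbT leqNgt; apply/negP => lt1q.
  have [|x [ltx _ _ _ e2]] := covers_stats lt2n chf lt1n; first by apply: nch; lia.
  by zero_cases h lt1n; zero_cases f ltx.
have fT1 : f 1 = n.-1.
  rewrite -fT; congr (f _); suff : bw f n.-1 <> 0 by lia.
  by move=> e; rewrite e in fT; lia.
(* The last position differs from [(bw h 0).+2 = 3] because [n] is at least 5. *)
have [|x [ltx _ e0 _ e2]] := covers_stats lt2n chf ltl; first by apply: nch; lia.
have ltlb : h n.-1 < h 0.
  by have := above n.-1 ltl; have := fw_neq h (i := n.-1) (j := 0); lia.
clear Sq ST.
first_cases h ltl; zero_cases h ltl; first_cases f ltx; zero_cases f ltx.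
have x1 : x = 1 by lia.
by subst x; lia.
Qed.

End OneUpperRight.

Lemma upper_right_both_empty n (f h : nperm n) z : 4 < n -> conn n f -> conn n h ->
  covers n f h -> covers n h f ->
  no_upper_right f -> f 0 < n.-1 -> bw f 0 < n.-1 -> h 0 < n.-1 -> bw h 0 < n.-1 ->
  ~ upper_right h z.
Proof.
move=> lt4n cf ch cfh chf nf lta ltp ltb ltq urz.
have lt2n : 2 < n by lia.
have lt1n : 1 < n by lia.
have [a0 p0 _ _ fp] := corner_pos cf lt1n; have [b0 q0 _ _ hq] := corner_pos ch lt1n.
(* Inversion exchanges the two shapes, so one exclusion serves both. *)
suff [[ea ep]|[ea ep]] : f 0 = h 0 /\ bw f 0 = (bw h 0).+1 \/
    f 0 = (h 0).+1 /\ bw f 0 = bw h 0.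
- exact: (upper_right_shifted_absurd lt4n cf ch cfh chf).
- apply: (@upper_right_shifted_absurd n (inv f) (inv h)) => //;
    try exact: conn_inv; try exact: covers_inv; exact: no_upper_right_inv.
have nc x : x < n -> noncut n f x by apply: no_upper_right_all_noncut.
have {z urz}[z urz ncz] := noncut_upper_right ch urz.
have ltl : n.-1 < n by lia.
have ltT : bw f n.-1 < n by exact: bw_lt.
have [x0 [ltx0 _ e0 _ e2]] := covers_stats lt2n chf (proj1 (andP (proj1 (andP urz)))) ncz.
have [y1 [lty1 _ e0T _ e2T]] := covers_stats lt2n cfh ltT (nc _ ltT).
have [y2 [lty2 _ e0R _ e2R]] := covers_stats lt2n cfh ltl (nc _ ltl).
have ltr := no_upper_right_lt (i := n.-1) nf ltac:(lia).
have ltt := no_upper_right_lt (i := n.-1) (no_upper_right_inv nf) ltac:(rewrite /=; lia).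
have fT : f (bw f n.-1) = n.-1 by exact: bwK.
have nx : bw f 0 < x0 -> f x0 < f 0.
  by move=> ?; apply: no_upper_right_lt; rewrite ?ltx0 ?andbT.
rewrite /= in ltt; case/andP: urz => /andP[ltz ltqz] ltbz.
move: ltT ltt fT e0T e2T; set t := bw f n.-1 => ltT ltt fT e0T e2T.
clear cfh chf cf ch nf nc.
have [eT eT2] : del f t 0 = f 0 /\ del (bw f) (f t) 0 = (bw f 0).-1.
  by first_cases f ltT; zero_cases f ltT.
have [eR eR2] : del f n.-1 0 = (f 0).-1 /\ del (bw f) (f n.-1) 0 = bw f 0.
  by first_cases f ltl; zero_cases f ltl.
have [ez ez2] : del h z 0 = h 0 /\ del (bw h) (h z) 0 = bw h 0.
  by first_cases h ltz; zero_cases h ltz.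
rewrite {}eT {}eT2 {}eR {}eR2 {}ez {}ez2 in e0 e2 e0T e2T e0R e2R.
clear ltz ltqz ltbz ltl ltT ltt fT ltr.
have hy2 : bw h 0 = (bw f 0).-1 -> h 0 = f 0.
  by clear - e0R e2R lty2 a0 p0 b0 q0 hq; first_cases h lty2; zero_cases h lty2.
have hy1 : h 0 = (f 0).-1 -> bw h 0 = bw f 0.
  by clear - e0T e2T lty1 a0 p0 b0 q0 hq; first_cases h lty1; zero_cases h lty1.
clear - hy1 hy2 e0 e2 ltx0 nx a0 p0 b0 q0 fp.
have [eb|/eqP nb] := eqVneq (h 0) (f 0).-1; first by have := hy1 eb; lia.
have [eq|/eqP nq] := eqVneq (bw h 0) (bw f 0).-1; first by have := hy2 eq; lia.
(* Neither coordinate drops by one, so the entry deleted from [f] would lie in its empty region. *)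
clear hy1 hy2.
by first_cases f ltx0; zero_cases f ltx0.
Qed.

(** * Permutations starting with their maximum *)

Lemma max_first_noncut n (g : nperm n) x : x < n -> g 0 = n.-1 -> 0 < x -> noncut n g x.
Proof.
move=> ltx g0 x0; apply: noncut_intro => // A sep i j lti ltj nix njx Ai nAj.
have lt0n : 0 < n by lia.
have n0x : 0 <> x by lia.
have A0 : A 0 by apply/negPn/negP => nA; case: (sep i 0 lti lt0n nix n0x Ai nA).
have [_] := sep 0 j lt0n ltj n0x njx A0 nAj.
by have := fw_lt g ltj; lia.
Qed.

Section MaximumFirst.
Variables (n : nat) (f h : nperm n).
Hypotheses (lt3n : 3 < n) (cf : conn n f) (ch : conn n h).
Hypotheses (cfh : covers n f h) (chf : covers n h f).

(** All children of [f] that keep its first entry are connected and start with their maximum.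
    Otherwise [h] yields such a child only by losing its first entry or its maximum. *)
Lemma max_first_transfer : f 0 = n.-1 -> h 0 = n.-1.
Proof.
move=> fmax; apply/eqP/negPn/negP => nh.
have lt0n : 0 < n by lia.
have lt1n : 1 < n by lia.
have lt2n : 2 < n by lia.
have [_ q0 b0 ltq hq] := corner_pos ch lt1n.
have {nh}ltb : h 0 < n.-1 by lia.
have nc x : 0 < x < n -> noncut n f x by case/andP=> *; apply: max_first_noncut.
have first_max y : y < n -> del h y 0 = n.-2 ->
    y = 0 /\ h 1 = n.-1 \/ h 0 = n.-2 /\ h y = n.-1.
  by clear -ltb lt3n lt0n lt1n => lty; have := fw_lt h lty; have := fw_lt h lt1n;
      have := fw_neq h lt0n lt1n; first_cases h lty.
have first_f x : 0 < x < n -> del f x 0 = n.-2.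
  case/andP=> x0 ltx; have := fw_lt f ltx; have := fw_neq f ltx lt0n.
  by clear -fmax x0 ltx; first_cases f ltx.
have second_f x x' : 0 < x < n -> 0 < x' < n -> del f x 1 = del f x' 1.
  move=> ltx ltx'.
  have [y [lty _ e0 e1 _]] := covers_stats lt2n cfh (proj2 (andP ltx)) (nc _ ltx).
  have [y' [lty' _ e0' e1' _]] := covers_stats lt2n cfh (proj2 (andP ltx')) (nc _ ltx').
  rewrite e1 e1'; rewrite !first_f // in e0 e0'.
  (* If both ways occur, [h] starts with [n.-2], [n.-1], and they give the same second entry. *)
  have h12 : h 0 = n.-2 -> h 1 = n.-1 -> del h 0 1 = del h 1 1.
    move=> h0 h1; rewrite !del_ge // h0 h1.
    have := fw_neq h (i := 2) (j := 0); have := fw_neq h (i := 2) (j := 1).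
    by have := fw_lt h lt2n; rewrite /unbump; lia.
  have bT i : i < n -> h i = n.-1 -> i = bw h n.-1 by move=> lti <-; rewrite fwK.
  case: (first_max y lty (esym e0)) (first_max y' lty' (esym e0')) => [[y0 h1]|[h0 hy]] [[y0' h1']|[h0' hy']].
  - by rewrite y0 y0'.
  - by rewrite y0 (bT y' lty' hy') -(bT 1 lt1n h1) h12.
  - by rewrite y0' (bT y lty hy) -(bT 1 lt1n h1') -h12.
  - by rewrite (bT y lty hy) (bT y' lty' hy').
(* Otherwise the minimum and the value [n.-2] stand beyond the second entry, and deleting them gives
   different second entries. *)
have nc0_f1 : noncut n f 0 -> f 1 = n.-2.
  move=> nc0; apply/eqP/negPn/negP => nf1.
  have ltz := bw_lt f lt0n; have fz := bwK f lt0n.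
  have ltj : bw f n.-2 < n by apply: bw_lt; lia.
  have fj : f (bw f n.-2) = n.-2 by apply: bwK; lia.
  have f1pos : f 1 <> 0.
    move=> f1; apply: (closed_conn (k := 1) nc0); first by lia.
    by case=> // _; rewrite del_ge // /unbump f1; lia.
  move: ltz fz ltj fj; set z := bw f 0; set j := bw f n.-2 => ltz fz ltj fj.
  have z1 : 1 < z.
    by clear -fz f1pos fmax lt3n; case: z fz => [|[|z]] //; lia.
  have j1 : 1 < j.
    by clear -fj nf1 fmax lt3n; case: j fj => [|[|j]] //; lia.
  have := second_f z j ltac:(lia) ltac:(lia); rewrite !del_lt // fz fj.
  by have := fw_neq f (i := 1) (j := 0); have := fw_lt f lt1n; rewrite /unbump; lia.
have K1 y : y < n -> noncut n h y -> y = 0 /\ h 1 = n.-1 \/ h 0 = n.-2 /\ h y = n.-1.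
  move=> lty ncy; apply: first_max => //.
  have [x [ltx ncx S]] := chf lty ncy; rewrite (same_first lt1n S).
  have [x0|x0] := posnP x; last by apply: first_f; rewrite x0.
  rewrite {x ltx S}x0 in ncx *; rewrite del_ge // fmax (nc0_f1 ncx) /unbump.
  by lia.
have h1 : h 1 = n.-1.
  by case: (first_or_bottom ch lt0n) => /K1 [] //; lia.
have hlast : h n.-1 <> n.-1.
  by have := fw_neq h (i := n.-1) (j := 1); lia.
have h0 : h 0 = n.-2.
  have ltl : n.-1 < n by lia.
  case: (last_or_top ch lt1n) => [/(K1 _ ltl)|/(K1 _ (bw_lt h ltl))]; first by lia.
  by rewrite -h1 fwK //; lia.
have /(K1 2 lt2n) : noncut n h 2.
  apply: noncut_last_lt_first => //; try lia.
  by have := fw_neq h (i := n.-1) (j := 0); have := fw_lt h (i := n.-1); lia.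
by have := fw_neq h (i := 2) (j := 1); lia.
Qed.

End MaximumFirst.

Definition all_covers m (f h : nat -> nat) :=
  forall x, x < m -> exists2 y, y < m & same m f x h y.

(* When the maximum comes first, no other entry is a cut vertex, so that all
   children of what remains are available, connected or not. *)
Section FullDeck.
Variables (m : nat) (f h : nperm m).
Hypotheses (lt3m : 3 < m) (cfh : all_covers m f h) (chf : all_covers m h f).

Lemma all_covers_stats x : x < m ->
  exists y, [/\ y < m, same m f x h y, del f x 0 = del h y 0 & del f x 1 = del h y 1].
Proof.
move=> ltx; have [y lty S] := cfh ltx.
by exists y; split=> //; apply: S; lia.
Qed.

Lemma all_covers_stats' y : y < m ->
  exists x, [/\ x < m, same m h y f x, del h y 0 = del f x 0 & del h y 1 = del f x 1].
Proof.
move=> lty; have [x ltx S] := chf lty.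
by exists x; split=> //; apply: S; lia.
Qed.

(** Otherwise deleting the maximum and the minimum of [h] forces [f 1 = (h 0).+1] and
    [h 0 = (f 0).+1]. Two deletions in [f] then agree in the first entry but not in the second,
    where [h] allows only one second entry. *)
Lemma full_deck_first_lt_max : f 0 < h 0 -> ~~ conn m f -> h 0 = m.-1.
Proof.
move=> ltab /nconn[k ltk ck]; apply/eqP/negPn/negP => nb.
have lt0m : 0 < m by lia.
have lt1m : 1 < m by lia.
have ltb : h 0 < m.-1 by have := fw_lt h lt0m; lia.
have f1 : f 1 = (h 0).+1.
  have lty : bw h m.-1 < m by apply: bw_lt; lia.
  have hy : h (bw h m.-1) = m.-1 by apply: bwK; lia.
  move: lty hy; set y := bw h m.-1 => lty hy.
  have [x [ltx _ e0 _]] := all_covers_stats' lty.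
  by clear -ltab ltb e0 lty ltx hy; first_cases h lty; first_cases f ltx.
have eb : h 0 = (f 0).+1.
  have lty : bw h 0 < m by apply: bw_lt; lia.
  have hy : h (bw h 0) = 0 by apply: bwK; lia.
  move: lty hy; set y := bw h 0 => lty hy.
  have [x [ltx _ e0 _]] := all_covers_stats' lty.
  by clear -ltab f1 e0 lty ltx hy; first_cases h lty; first_cases f ltx.
have [a0|a0] := posnP (f 0).
  have lt2 v : v < m -> f 0 < v -> v <> 2 -> 1 < bw f v.
    move=> ltv fv v2; have := bwK f ltv.
    by case: (bw f v) => [|[|z]] //; lia.
  have lt1 : bw f 1 < m by exact: bw_lt.
  have lt3 : bw f 3 < m by exact: bw_lt.
  have g1 := lt2 1 lt1m ltac:(lia) ltac:(lia).
  have g3 := lt2 3 lt3m ltac:(lia) ltac:(lia).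
  have [y [lty _ e0 e1]] := all_covers_stats lt1.
  have [y' [lty' _ e0' e1']] := all_covers_stats lt3.
  rewrite !(del_lt f) // ?bwK // in e0 e1 e0' e1'; try lia.
  have first0 z : z < m -> del h z 0 = 0 -> z = 0 /\ h 1 = 0 \/ h z = 0.
    move=> ltz; have := fw_neq h lt0m lt1m.
    by clear -eb a0 ltab ltz; first_cases h ltz.
  have h12 : h 1 = 0 -> del h 0 1 = del h 1 1.
    move=> h1; rewrite !del_ge // h1 eb a0.
    have := fw_neq h (i := 2) (j := 0); have := fw_neq h (i := 2) (j := 1).
    by rewrite /unbump; lia.
  have bB i : i < m -> h i = 0 -> i = bw h 0 by move=> lti <-; rewrite fwK.
  have {e0}fy := first0 y lty ltac:(rewrite -e0 a0 /unbump; lia).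
  have {e0'}fy' := first0 y' lty' ltac:(rewrite -e0' a0 /unbump; lia).
  suff : del h y 1 = del h y' 1 by rewrite -e1 -e1' f1 eb a0 /unbump; lia.
  case: fy fy' => [[-> h1]|hy] [[-> h1']|hy'] //.
  - by rewrite (bB y' lty' hy') -(bB 1 lt1m h1) h12.
  - by rewrite (bB y lty hy) -(bB 1 lt1m h1') -h12.
  - by rewrite (bB y lty hy) (bB y' lty' hy').
have h1 : h 1 = (f 0).-1.
  have ltx : bw f 0 < m by apply: bw_lt; lia.
  have fx : f (bw f 0) = 0 by apply: bwK; lia.
  move: ltx fx; set x := bw f 0 => ltx fx.
  have [y [lty _ e0 _]] := all_covers_stats ltx; have := fw_neq h lt0m lt1m.
  by clear -a0 eb e0 lty ltx fx; first_cases f ltx; first_cases h lty.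
have ltk' : (f 0).+3 <= k.
  have := ck 1; rewrite f1 eb; have := ck 0.
  have : k <> 1 by move=> k1; have := ck 0; lia.
  by lia.
have hfix y : y < m -> del h y 0 = f 0 -> f 0 < del h y 1 ->
    y = 1 by clear -h1 eb a0 lt3m => lty; first_cases h lty; second_cases h lty.
(* Deleting the value [(f 0).+1] lowers the second entry; deleting the last entry, which lies above
   the closed block, does not. *)
have ltx : bw f (f 0).+1 < m by apply: bw_lt; lia.
have fx : f (bw f (f 0).+1) = (f 0).+1 by apply: bwK; lia.
have x1 : 1 < bw f (f 0).+1.
  by move: fx; case: (bw f _) => [|[|z]] //; rewrite ?f1; lia.
have [y [lty _ e0 e1]] := all_covers_stats ltx.
rewrite !(del_lt f) ?fx in e0 e1; try lia.
have ey : y = 1.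
  by apply: hfix => //; rewrite -?e0 -?e1 ?f1 ?eb /unbump; lia.
have ltl : m.-1 < m by lia.
have fl : k <= f m.-1 by apply: closed_ge ck; lia.
have [y' [lty' _ e0' e1']] := all_covers_stats ltl.
rewrite !(del_lt f) in e0' e1'; try lia.
have ey' : y' = 1.
  by apply: hfix => //; rewrite -?e0' -?e1' ?f1 ?eb /unbump; lia.
by move: e1 e1'; rewrite ey ey' => <-; rewrite f1 eb /unbump; lia.
Qed.

(** The children of [h] that keep its first entry start with their maximum. A disconnected [f] then
    starts with 0, [m.-1], or starts with [m.-2] and ends with [m.-1]; in either case all these
    children coincide, which a few entries refute. *)
Lemma full_deck_max_absurd : h 0 = m.-1 -> conn m f.
Proof.
move=> hmax; apply/negPn/negP => /nconn[k ltk ck].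
have lt0m : 0 < m by lia.
have lt1m : 1 < m by lia.
have lt2m : 2 < m by lia.
have ltl : m.-1 < m by lia.
have a_k : f 0 < k by apply: ck; lia.
have first_h y : y < m -> 0 < y -> del h y 0 = m.-2.
  move=> lty y0; rewrite del_lt // hmax.
  by have := fw_lt h lty; have := fw_neq h lt0m lty; rewrite /unbump; lia.
have first_f x : x < m -> del f x 0 = m.-2 ->
    x = 0 /\ f 1 = m.-1 \/ f 0 = m.-2 /\ f x = m.-1.
  move=> ltx; have := fw_lt f ltx; have := fw_lt f lt1m; have := fw_neq f lt0m lt1m.
  by clear -a_k ltk ltx; first_cases f ltx.
have dich y : y < m -> 0 < y -> exists x, [/\ x < m, same m h y f x &
    x = 0 /\ f 1 = m.-1 \/ f 0 = m.-2 /\ f x = m.-1].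
  move=> lty y0; have [x [ltx S e0 _]] := all_covers_stats' lty.
  by exists x; split=> //; apply: first_f => //; rewrite -e0 first_h.
have k1 : f 1 = m.-1 -> k = 1.
  by move=> f1; have := ck 1; rewrite f1; lia.
have [f1|/eqP nf1] := eqVneq (f 1) m.-1.
  have a0 : f 0 = 0 by have := k1 f1; lia.
  have S0 y : y < m -> 0 < y -> same m h y f 0.
    by move=> lty y0; have [x [ltx S [[<- _]//|]]] := dich y lty y0; lia.
  have T0 x : x < m -> 0 < x -> del h 0 0 = 0 /\ del f x 1 = del h 0 1.
    move=> ltx x0; have := fw_neq f ltx lt0m.
    have [y [lty S e0 e1]] := all_covers_stats ltx.
    rewrite del_lt // a0 in e0 => nx; have [y0|y0] := posnP y.
      by rewrite y0 in e0 e1; split=> //; rewrite -e0 /unbump; lia.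
    by rewrite first_h // in e0; rewrite /unbump in e0; lia.
  have [h00 e1] := T0 1 lt1m ltac:(lia); have [_ e2] := T0 2 lt2m ltac:(lia).
  have h1 : h 1 = 0.
    move: h00; rewrite del_ge // hmax.
    by have := fw_lt h lt1m; rewrite /unbump; lia.
  have := S0 1 lt1m ltac:(lia) 1 ltac:(lia); have := S0 2 lt2m ltac:(lia) 1 ltac:(lia).
  move: e1 e2; rewrite (del_ge f (leqnn 1)) (del_lt f (ltnSn 1)) (del_ge h (leq0n 1)).
  rewrite (del_ge h (leqnn 1)) (del_lt h (ltnSn 1)) (del_ge f (leq0n 1)).
  have := fw_neq f (i := 2) (j := 1); have := fw_neq f (i := 2) (j := 0).
  have := fw_neq h (i := 2) (j := 1); have := fw_lt f lt2m.
  by rewrite f1 h1 hmax a0 /unbump; lia.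
have [a x0] : f 0 = m.-2 /\ forall y, y < m -> 0 < y -> same m h y f m.-1.
  have [x [_ _ [[]//|[a fx]]]] := dich 1 lt1m isT.
  split=> // y lty y0; have [x' [ltx' S [[]//|[_ fx']]]] := dich y lty y0.
  suff -> : m.-1 = x' by [].
  have [//|/eqP ne] := eqVneq m.-1 x'.
  have kl : k = m.-1 by lia.
  have : f m.-1 < m by apply: fw_lt; lia.
  have : k <= f m.-1 by apply: closed_ge ck; lia.
  by have := fw_neq f ltl ltx' ne; lia.
have fl : f m.-1 = m.-1.
  have : f m.-1 < m by apply: fw_lt; lia.
  have : k <= f m.-1 by apply: closed_ge ck; lia.
  by lia.
(* This child ends with its maximum, so [h] must have lost its first entry. *)
have S0 x : x < m.-1 -> same m f x h 0.
  move=> ltx; have ltxm : x < m by lia.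
  have [y [lty S e0 _]] := all_covers_stats ltxm.
  have [y0|y0] := posnP y; first by rewrite y0 in S.
  rewrite first_h // in e0.
  have e1 : del f x m.-2 = m.-2.
    rewrite del_ge; last by lia.
    have := fw_neq f ltxm ltl; have := fw_lt f ltxm.
    by rewrite (_ : m.-2.+1 = m.-1) ?fl /unbump; lia.
  by have := fw_neq (child f ltxm) (i := 0) (j := m.-2); rewrite /= e0 e1; lia.
have f1 : f 1 = m.-2.-1.
  have := S0 0 ltac:(lia) 0 ltac:(lia); rewrite -(S0 1 ltac:(lia) 0 ltac:(lia)).
  rewrite del_ge // del_lt // a; have := fw_lt f lt1m; have := fw_neq f lt0m lt1m.
  by rewrite /unbump; lia.
have hl : h m.-1 = m.-2.
  have := S0 0 ltac:(lia) m.-2 ltac:(lia); rewrite !del_ge //.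
  have := fw_neq h lt0m ltl; have := fw_lt h ltl.
  by rewrite (_ : m.-2.+1 = m.-1) ?fl ?hmax ?a /unbump; lia.
have := x0 1 lt1m isT m.-2 ltac:(lia); rewrite del_ge; last by lia.
rewrite del_lt; last by lia.
have := fw_neq h lt1m ltl; have := fw_neq f (i := 1) (j := m.-2).
have := fw_lt h lt1m; have := fw_neq h lt0m lt1m.
by rewrite (_ : m.-2.+1 = m.-1) ?fl ?hl ?hmax ?f1 /unbump; lia.
Qed.

(** Two children of [f] show that [f 0 = m.-2] and [h 2 = m.-1]; deleting position 3 of [h] then
    lowers both of its first entries, giving a start that [f] cannot match. *)
Lemma full_deck_opposite_runs : f 0 = h 0 -> f 1 = (f 0).+1 -> h 0 = (h 1).+1 -> False.
Proof.
move=> E f1 h1; have lt0m : 0 < m by lia.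
have lt1m : 1 < m by lia.
have lt2m : 2 < m by lia.
have ltf1 := fw_lt f lt1m.
have max1 : f 0 = m.-2.
  apply/eqP/negPn/negP => na.
  have ltx : bw f (f 0).+2 < m by apply: bw_lt; lia.
  have fx : f (bw f (f 0).+2) = (f 0).+2 by apply: bwK; lia.
  have x1 : 1 < bw f (f 0).+2.
    by move: fx; case: (bw f _) => [|[|z]] //; lia.
  have [y [lty _ e0 e1]] := all_covers_stats ltx.
  rewrite !(del_lt f) ?fx ?f1 in e0 e1; try lia.
  have e : y = 1 -> h y = h 1 by move->.
  have [{}e0 {}e1] : del h y 0 = f 0 /\ del h y 1 = (f 0).+1.
    by rewrite -e0 -e1 /unbump; lia.
  by clear -e e0 e1 E h1 lty; first_cases h lty; second_cases h lty.
have ltx : bw f (f 0).-1 < m by apply: bw_lt; lia.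
have fx : f (bw f (f 0).-1) = (f 0).-1 by apply: bwK; lia.
have x1 : 1 < bw f (f 0).-1.
  by move: fx; case: (bw f _) => [|[|z]] //; lia.
have [y [lty _ e0 e1]] := all_covers_stats ltx.
rewrite !(del_lt f) ?fx ?f1 in e0 e1; try lia.
have h2 : h 2 = m.-1.
  have [{}e0 {}e1] : del h y 0 = (f 0).-1 /\ del h y 1 = f 0.
    by rewrite -e0 -e1 /unbump; lia.
  have e : y = 1 -> h y = h 1 by move->.
  have := fw_neq h lt0m lt2m.
  by clear -e e0 e1 E h1 max1 lty lt3m; second_cases h lty; first_cases h lty.
have h3 : h 3 < h 1.
  have := fw_neq h (i := 3) (j := 0); have := fw_neq h (i := 3) (j := 1).
  by have := fw_neq h (i := 3) (j := 2); have := fw_lt h lt3m; lia.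
have [x' [ltx' e0' e1']] : exists x', [/\ x' < m, del f x' 0 = (f 0).-1 & del f x' 1 = (f 0).-2].
  have [x' [ltx' _ e0' e1']] := all_covers_stats' lt3m.
  exists x'; split=> //; [rewrite -e0'|rewrite -e1']; rewrite del_lt // /unbump; lia.
have e : x' = 1 -> f x' = f 1 by move->.
by clear -e e0' e1' f1 E h1 h3 ltx'; first_cases f ltx'; second_cases f ltx'.
Qed.

End FullDeck.

Lemma full_deck_eq m (f h : nperm m) : 3 < m -> all_covers m f h -> all_covers m h f ->
  (conn m f -> f 0 = m.-1) -> (conn m h -> h 0 = m.-1) -> eqn_on m f h.
Proof.
move=> lt3m cfh chf maxf maxh; have lt0m : 0 < m by lia.
have lt1m : 1 < m by lia.
have fm := fw_lt f lt0m; have hm := fw_lt h lt0m.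
have [ltab|ltba|E] := ltngtP (f 0) (h 0).
- have nf : ~~ conn m f by apply/negP => /maxf; lia.
  by case/negP: (nf); apply: (full_deck_max_absurd lt3m cfh chf); apply: (full_deck_first_lt_max lt3m cfh chf).
- have nh : ~~ conn m h by apply/negP => /maxh; lia.
  by case/negP: (nh); apply: (full_deck_max_absurd lt3m chf cfh); apply: (full_deck_first_lt_max lt3m chf cfh).
have [y lty S] := cfh 0 lt0m; have [x ltx S'] := chf 0 lt0m.
have [//|[_ adjf]] := same_first_adjacent lt1m lty E S.
have [eqhf|[_ adjh]] := same_first_adjacent lt1m ltx (esym E) S'.
  by move=> i lti; rewrite eqhf.
case: adjf adjh => [f1|f1] [h1|h1].
- exact: (inc_run_eq (x := x) (y := y)).
- by case: (full_deck_opposite_runs lt3m cfh chf).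
- by case: (full_deck_opposite_runs lt3m chf cfh).
- exact: (dec_run_eq (x := x) (y := y)).
Qed.

Lemma max_first_all_covers n (f h : nperm n) : 1 < n -> covers n f h -> f 0 = n.-1 ->
  all_covers n.-1 (del f 0) (del h 0).
Proof.
move=> lt1n c fmax x ltx; have ltx1 : x.+1 < n by lia.
have [y [lty _ S]] := c x.+1 ltx1 (max_first_noncut ltx1 fmax isT).
exists y.-1; first by lia.
move=> k ltk; rewrite -[x]/(x.+1.-1) -del_del //.
rewrite (del_ext S) //; last by lia.
(* For [y = 0] the first entry is deleted twice, in agreement with [y.-1 = 0]. *)
by case: y lty S => [//|y] lty S; rewrite del_del.
Qed.

Lemma max_first_eq n (f h : nperm n) : 4 < n -> covers n f h -> covers n h f ->
  f 0 = n.-1 -> h 0 = n.-1 -> eqn_on n f h.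
Proof.
move=> lt4n cfh chf fmax hmax; have lt0n : 0 < n by lia.
have lt1n : 1 < n by lia.
have E : f 0 = h 0 by rewrite fmax.
(* A connected remainder is itself a child of [g']: either its remainder, which gives equality, or
   one that keeps the leading maximum. *)
have max_or_eq (g g' : nperm n) : covers n g g' -> g 0 = n.-1 -> g' 0 = n.-1 ->
    conn n.-1 (del g 0) -> del g 0 0 = n.-2 \/ eqn_on n g g'.
  move=> c gmax gmax' nc; have [y [lty _ S]] := c 0 lt0n nc.
  have [y0|y0] := posnP y.
    by right; apply: same00_eq; [rewrite gmax | rewrite -{1}y0 in S * ; rewrite y0 in S].
  left; rewrite (same_first lt1n S) del_lt // gmax'.
  by have := fw_lt g' lty; have := fw_neq g' lty lt0n; rewrite /unbump; lia.
have max_f (g g' : nperm n) : covers n g g' -> g 0 = n.-1 -> g' 0 = n.-1 ->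
    eqn_on n g g' \/ (conn n.-1 (del g 0) -> del g 0 0 = n.-2).
  move=> c gmax gmax'; have [nc|_] := boolP (conn n.-1 (del g 0)); last by right.
  by case: (max_or_eq g g' c gmax gmax' nc); [right | left].
have [//|mf] := max_f f h cfh fmax hmax.
have [eqhf|mh] := max_f h f chf hmax fmax; first by move=> i lti; rewrite eqhf.
apply: same00_eq => //.
apply: (full_deck_eq (f := child f lt0n) (h := child h lt0n)) => //; first by lia.
- exact: max_first_all_covers.
- exact: max_first_all_covers.
Qed.

(** * Shifted corners *)

(* Composing the two coincidences of children embeds [f] into itself, moving
   each entry to its successor in an oscillation.  This forces [f] to increase
   up to its minimum, and if the first value exceeded 1, the entry of value 1
   could be deleted, giving a child that [h] does not have. *)
Section ShiftedCorner.
Variables (n : nat) (f h : nperm n) (x y : nat).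
Hypotheses (lt2n : 2 < n) (cf : conn n f) (ch : conn n h) (cfh : covers n f h).
Hypotheses (eb : h 0 = (f 0).+1) (ep : bw f 0 = (bw h 0).+1) (f1 : f 1 = (f 0).+2).
Hypotheses (ury : upper_right h y) (Sy : same n f 0 h y).
Hypotheses (urx : upper_right f x) (Sx : same n h (bw h 0) f x).

Let q := bw h 0.

Lemma shift_f_h k : k < y -> unbump (f 0) (f k.+1) = unbump (h y) (h k).
Proof.
case/andP: ury => /andP[lty _] _ ltk.
by have := Sy (k := k) ltac:(lia); rewrite del_ge // del_lt.
Qed.

Lemma shift_h_f k : k < q -> unbump 0 (h k) = unbump (f x) (f k).
Proof.
rewrite /q => ltk; case/andP: urx => /andP[ltx ltpx] _; rewrite ep in ltpx.
have [_ _ _ _ hq] := corner_pos ch ltac:(lia).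
have := Sx (k := k) ltac:(lia); rewrite del_lt // hq => ->.
by rewrite del_lt //; lia.
Qed.

Lemma shift_h_f_ge k : q <= k < x -> unbump 0 (h k.+1) = unbump (f x) (f k).
Proof.
rewrite /q => ltk; case/andP: urx => /andP[ltx ltpx] _; rewrite ep in ltpx.
have [_ _ _ _ hq] := corner_pos ch ltac:(lia).
have := Sx (k := k) ltac:(lia); rewrite del_ge ?hq; last by lia.
by move=> ->; rewrite del_lt //; lia.
Qed.

(** Deletion preserves order: a comparison in [f] passes to [h] through [Sx] and returns one
    position later through [Sy]. *)
Lemma shifted_corner_increasing i : i < q -> f i < f i.+1.
Proof.
case/andP: ury => /andP[lty ltqy] _; case/andP: urx => /andP[ltx ltpx] _.
rewrite /q; elim: i => [|i IH] lti; first by lia.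
have [_ _ _ _ hq] := corner_pos ch ltac:(lia).
have h0 j : j < n -> j <> bw h 0 -> h j <> 0 by move=> ltj nj; rewrite -hq; apply: fw_neq => //; lia.
rewrite -(@ltn_unbump (f 0)); try (apply: fw_neq; lia).
rewrite !shift_f_h; try lia.
rewrite ltn_unbump; try (apply: fw_neq; lia).
rewrite -(@ltn_unbump 0); try (apply: h0; lia).
rewrite !shift_h_f; try (rewrite /q; lia).
rewrite ltn_unbump; try (apply: fw_neq; lia).
by apply: IH; lia.
Qed.

Lemma shifted_corner_first_le1 : f 0 <= 1.
Proof.
rewrite leqNgt; apply/negP => lt1a; have lt1n : 1 < n by lia.
have [a0 p0 lta ltp fp] := corner_pos cf lt1n; have [b0 q0 _ ltq hq] := corner_pos ch lt1n.
case/andP: (ury) => /andP[lty ltqy] ltby; case/andP: (urx) => /andP[ltx ltpx] ltax.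
have above w : 0 < w -> w <= q -> f 1 <= f w.
  elim: w => // w IH _ ltw; have [->//|w0] := posnP w.
  by apply: leq_trans (IH w0 (ltnW ltw)) (ltnW _); exact: shifted_corner_increasing.
rewrite /q in above.
have h1 : h (bw h 0).+2 = 1.
  have := shift_h_f_ge (k := (bw h 0).+1); rewrite -ep fp ep /q => /(_ ltac:(lia)).
  by have := fw_neq h (i := (bw h 0).+2) (j := bw h 0); rewrite /unbump; lia.
have ny : y <> (bw h 0).+2 by move=> e; rewrite e in ltby; lia.
(* [Sy] carries the value 1 of [h] to [f], one place later exactly if it stands before [y]. *)
have [s [lts fs s_p]] : exists s, [/\ s < n, f s = 1 &
    s = (bw h 0).+2 \/ s = (bw h 0).+3 /\ (bw h 0).+2 < y].
  have [lt2y|ley] := ltnP (bw h 0).+2 y.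
    exists (bw h 0).+3; split; [lia | | by right].
    by have := shift_f_h lt2y; rewrite h1 /unbump; lia.
  exists (bw h 0).+2; split; [lia | | by left].
  have := Sy (k := (bw h 0).+1) ltac:(lia); rewrite !del_ge //; last by lia.
  by rewrite h1 /unbump; lia.
have ncs : noncut n f s.
  apply/negPn/negP => /nconn[k ltk ck].
  have ck' i : i < n -> i <> s -> unbump s i < k -> unbump 1 (f i) < k.
    by move=> lti nis /ck; rewrite del_unbump // fs.
  have bk v : v < k -> v <> 0 -> unbump s (bw f v.+1) < k.
    move=> ltv v0; have := closed_bw (f := child f lts) _ ck ltv.
    by rewrite /= fs del_ge ?fwK -?fs ?fwK //; [apply; lia | lia].
  have les : k <= s.
    rewrite leqNgt; apply/negP => ltsk; apply: (closed_conn (k := k.+1) cf); first lia.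
    move=> i lti; have [->|/eqP nis] := eqVneq i s; first by lia.
    by have := ck' i; rewrite /unbump; lia.
  have ltpk : bw f 0 < k.
    have := closed_bw (f := child f lts) _ ck (v := 0).
    by rewrite /= del_zero ?fs // /unbump; lia.
  have := ck' 1 lt1n; rewrite f1 => lta1.
  have {}lta1 : f 0 < k by move: lta1; rewrite /unbump; lia.
  have := bk (f 0) lta1 ltac:(lia).
  have ltw : bw f (f 0).+1 < n by apply: bw_lt; have := fw_lt f lt1n; lia.
  have fw : f (bw f (f 0).+1) = (f 0).+1 by apply: bwK; have := fw_lt f lt1n; lia.
  move: ltw fw; set w := bw f (f 0).+1 => ltw fw wk.
  have ws : w <> s by move=> e; rewrite e in fw; lia.
  have {}wk : w < k by move: wk; rewrite /unbump; lia.
  have w0 : w <> 0 by move=> e; rewrite e in fw; lia.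
  have wp : w <> bw f 0 by move=> e; rewrite e in fw; lia.
  have wq : ~ w <= bw h 0 by move=> le; have := above w; lia.
  have [ew lt2y] : w = (bw h 0).+2 /\ (bw h 0).+2 < y by lia.
  (* Carried to [h] and back, this ascent gives [f q < f q.+2], but [f q.+2 = (f 0).+1] is less than
     [f 1 <= f q]. *)
  have := shifted_corner_increasing (i := (bw h 0).-1) ltac:(rewrite /q; lia).
  rewrite (_ : (bw h 0).-1.+1 = bw h 0); last by lia.
  rewrite -(@ltn_unbump (f x)); try (apply: fw_neq; lia).
  rewrite -shift_h_f -?shift_h_f_ge /q; try lia.
  have h0 j : j < n -> j <> bw h 0 -> h j <> 0.
    by move=> ltj nj; rewrite -hq; apply: fw_neq => //; lia.
  rewrite ltn_unbump; try (apply: h0; lia).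
  rewrite -(@ltn_unbump (h y)); try (apply: fw_neq; lia).
  rewrite -!shift_f_h; try lia.
  rewrite (_ : (bw h 0).-1.+1 = bw h 0); last by lia.
  rewrite ltn_unbump; try (apply: fw_neq; lia).
  by have := above (bw h 0); rewrite -ew fw; lia.
(* This child has the pair [((f 0).-1, bw f 0)]. In [h] the minimum reaches that position only if
   the old minimum is deleted, and then the first value is [f 0]. *)
have [y' [lty' _ e0 _ e2]] := covers_stats lt2n cfh lts ncs.
clear Sx Sy urx ury.
have ltas : f s < f 0 by lia.
have ltps : bw f 0 < s by lia.
clear s_p above.
by first_cases f lts; zero_cases f lts; zero_cases h lty'; first_cases h lty'.
Qed.

End ShiftedCorner.

(** * Oscillations *)

Definition inverts (f : nat -> nat) i j := (i < j) && (f j < f i) || (j < i) && (f i < f j).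

Definition path_from n (f : nat -> nat) e := exists2 v : nat -> nat, v 0 = e &
  [/\ forall i, i < n -> v i < n,
      forall i j, i < n -> j < n -> v i = v j -> i = j &
      forall i j, i < n -> j < n -> inverts f (v i) (v j) = (i.+1 == j) || (j.+1 == i)].

Lemma invertsC f i j : inverts f i j = inverts f j i.
Proof. by rewrite /inverts orbC. Qed.

(** The deleted entry is a leaf attached to the end [e] of the path and becomes its new start. *)
Lemma path_from_child n (f : nperm n) x e : x < n -> 1 < n ->
  path_from n.-1 (del f x) e ->
  (forall t, t < n -> t <> x -> inverts f x t = (t == bump x e)) ->
  path_from n f x.
Proof.
move=> ltx lt1n [v v0 [ltv injv adjv]] adjx.
have ltb k : k < n.-1 -> bump x k < n by rewrite /bump; lia.
have nb k : bump x k <> x by rewrite /bump; lia.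
have adj0 j : j < n.-1 -> inverts f x (bump x (v j)) = (j == 0).
  move=> ltj; rewrite adjx //; last by apply/ltb/ltv.
  rewrite -v0; apply/eqP/eqP => [/(can_inj (bumpK x)) E|->//].
  by apply: injv => //; lia.
exists (fun i => if i is j.+1 then bump x (v j) else x) => //; split.
- by case=> // i lti; apply/ltb/ltv; lia.
- case=> [|i] [|j] lti ltj //; [by move/esym/nb | by move/nb |].
  by move/(can_inj (bumpK x)) => E; congr _.+1; apply: injv E; lia.
case=> [|i] [|j] lti ltj; rewrite ?eqSS.
- by rewrite /inverts ltnn.
- by rewrite adj0; [rewrite eq_sym orbF | lia].
- by rewrite invertsC adj0; [rewrite eq_sym | lia].
rewrite -adjv; try lia.
have ltvi := ltv i ltac:(lia); have ltvj := ltv j ltac:(lia).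
have mono k l : (bump x k < bump x l) = (k < l) by apply/idP/idP; rewrite /bump; lia.
rewrite /inverts !mono /del !ltn_unbump //;
  apply: fw_neq => //; exact: ltb.
Qed.

Lemma path_from_231 (f : nat -> nat) : f 0 = 1 -> f 1 = 2 -> f 2 = 0 -> path_from 3 f 0.
Proof.
move=> f0 f1 f2; exists (nth 0 [:: 0; 2; 1]) => //; split.
- by case=> [|[|[|]]].
- by case=> [|[|[|i]]] [|[|[|j]]].
by case=> [|[|[|i]]] [|[|[|j]]] // _ _; rewrite /inverts /= ?f0 ?f1 ?f2.
Qed.

Lemma path_from_312 (f : nat -> nat) : f 0 = 2 -> f 1 = 0 -> f 2 = 1 -> path_from 3 f 1.
Proof.
move=> f0 f1 f2; exists (nth 0 [:: 1; 0; 2]) => //; split.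
- by case=> [|[|[|]]].
- by case=> [|[|[|i]]] [|[|[|j]]].
by case=> [|[|[|i]]] [|[|[|j]]] // _ _; rewrite /inverts /= ?f0 ?f1 ?f2.
Qed.

Lemma noncut_first_lt2 n (f : nperm n) : conn n f -> f 0 < 2 -> noncut n f 0.
Proof. by move=> cf ltf; apply/negPn/negP => /(cut_first_second cf); lia. Qed.

Lemma shifted_corner_second n (f h : nperm n) y : 3 < n -> conn n f -> y < n ->
  f 0 = 1 -> bw f 0 = 2 -> h 0 = 2 -> bw h 0 = 1 -> same n f 0 h y ->
  f 1 = 3 /\ 1 < y.
Proof.
move=> lt3n cf lty f0 p h0 q S; have lt1n : 1 < n by lia.
have f2 : f 2 = 0 by rewrite -p bwK //; lia.
have h1 : h 1 = 0 by rewrite -q bwK //; lia.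
have f1_0 := fw_neq f (i := 1) (j := 0); have f1_2 := fw_neq f (i := 1) (j := 2).
have f12 : f 1 <> 2.
  move=> f1; apply: (closed_conn (k := 3) cf) => //.
  by case=> [|[|[|]]] // _; rewrite ?f0 ?f1 ?f2.
have := same_first lt1n S; rewrite del_ge // f0.
have : y = 1 -> h y = 0 by move->.
by first_cases h lty; rewrite /unbump; lia.
Qed.

(* Induction applies to the pair of children (h - min, f - first), in this
   order: it is again a shifted pair. *)
Lemma shifted_corner_paths n (f h : nperm n) x y : 2 < n -> conn n f -> conn n h ->
  f 0 = 1 -> bw f 0 = 2 -> h 0 = 2 -> bw h 0 = 1 ->
  y < n -> same n f 0 h y -> x < n -> same n h 1 f x ->
  path_from n f 0 /\ path_from n h 1.
Proof.
elim: n f h x y => // n IH f h x y lt2n cf ch f0 p h0 q lty Sy ltx Sx.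
have f2 : f 2 = 0 by rewrite -p bwK.
have h1 : h 1 = 0 by rewrite -q bwK //; lia.
(* In length 3 the two permutations are 231 and 312. *)
have [en|/eqP n2] := eqVneq n 2.
  rewrite {}en in f h cf ch f0 p h0 q f2 h1 {lt2n lty Sy ltx Sx IH} *.
  have nf := fw_neq f; have nh := fw_neq h.
  have f1 : f 1 = 2.
    by have := nf 1 0; have := nf 1 2; have := fw_lt f (i := 1); lia.
  have h2 : h 2 = 1.
    by have := nh 2 0; have := nh 2 1; have := fw_lt h (i := 2); lia.
  by split; [apply: path_from_231 | apply: path_from_312].
have lt3n : 3 < n.+1 by lia.
have lt0 : 0 < n.+1 by [].
have lt1 : 1 < n.+1 by lia.
have [f1 y1] := shifted_corner_second lt3n cf lty f0 p h0 q Sy.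
have Sx' := same_inv lt1 ltx Sx; rewrite h1 in Sx'.
have [q1 _] := shifted_corner_second (f := inv h) (h := inv f) lt3n (conn_inv ch)
  (fw_lt f ltx) q h0 p f0 Sx'.
rewrite /= in q1.
have cf1 : conn n (child f lt0) by apply: noncut_first_lt2 => //; rewrite f0.
have ch1 : conn n (child h lt1).
  rewrite /= -q; apply: noncut_bw => //; apply: (noncut_first_lt2 (f := inv h)) => /=.
    exact: conn_inv.
  by rewrite q.
have x0 : 0 < x.
  rewrite lt0n; apply/eqP => x0; rewrite x0 in Sx.
  have := same_first lt1 Sx; rewrite del_lt // del_ge // f0 f1 h0 h1.
  by rewrite /unbump.
have [|||||||||||ph pf] := IH (child h lt1) (child f lt0) y.-1 x.-1.
- by lia.
- exact: ch1.
- exact: cf1.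
- by rewrite /= del_lt // h0 h1.
- by rewrite /= h1 del_ge // q q1.
- by rewrite /= del_ge // f0 f1.
- by rewrite /= f0 del_lt // -f0 fwK // f0 p.
- by lia.
- move=> k ltk /=; rewrite -(@del_del n.+1 f) //; try lia.
  by rewrite (del_ext Sx) //; lia.
- by lia.
- move=> k ltk /=; rewrite -(@del_del n.+1 h) //; try lia.
  by rewrite (del_ext Sy) //; lia.
split.
  apply: (path_from_child lt0 lt1 pf) => t ltt nt; rewrite /inverts f0 /=.
  have : f t = 0 -> t = 2 by move=> ft; rewrite -p -ft fwK.
  have : t = 2 -> f t = 0 by move->.
  by rewrite /bump; lia.
apply: (path_from_child lt1 lt1 ph) => t ltt nt; rewrite /inverts h1 /=.
have : t = 0 -> h t = 2 by move->.
by rewrite /bump; lia.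
Qed.

(** Matching the pairs of the children at [z] and [z'] forces the shift by (1, -1) and identifies
    the deleted entries. The bound on the first value, used again for the inverses in exchanged
    roles, leaves the pairs (1, 2) and (2, 1). *)
Lemma shifted_corner n (f h : nperm n) z z' : 2 < n -> conn n f -> conn n h ->
  covers n f h -> covers n h f -> upper_right f z -> upper_right h z' -> f 0 < h 0 ->
  bw f 0 = (bw h 0).+1 /\ path_from n f 0 /\ path_from n h 1.
Proof.
move=> lt2n cf ch cfh chf urz urz' ltab; have lt1n : 1 < n by lia.
have lt0n : 0 < n by lia.
have [a0 p0 lta ltp fp] := corner_pos cf lt1n; have [b0 q0 ltb ltq hq] := corner_pos ch lt1n.
have {z urz}[z urz ncz] := noncut_upper_right cf urz.
have {z' urz'}[z' urz' ncz'] := noncut_upper_right ch urz'.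
case/andP: (urz) => /andP[ltz ltpz] ltaz; case/andP: (urz') => /andP[ltz' ltqz'] ltbz'.
have [x [ltx S' e0' _ e2']] := covers_stats lt2n chf ltz' ncz'.
have [y [lty S e0 _ e2]] := covers_stats lt2n cfh ltz ncz.
have [ez1 ez2] : del f z 0 = f 0 /\ del (bw f) (f z) 0 = bw f 0.
  by clear -ltz ltpz ltaz a0 p0; first_cases f ltz; zero_cases f ltz.
have [ez1' ez2'] : del h z' 0 = h 0 /\ del (bw h) (h z') 0 = bw h 0.
  by clear -ltz' ltqz' ltbz' b0 q0; first_cases h ltz'; zero_cases h ltz'.
rewrite {}ez1 {}ez2 in e0 e2; rewrite {}ez1' {}ez2' in e0' e2'.
have [x0 f1] : x = 0 /\ f 1 = (h 0).+1.
  by clear -e0' ltx ltab; first_cases f ltx.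
have ep : bw f 0 = (bw h 0).+1.
  by rewrite x0 in ltx e2'; clear -e2' ltx a0 p0; zero_cases f ltx.
have [ey q1] : y = bw h 0 /\ bw h 1 = (bw h 0).+2.
  by clear -e2 lty ep; zero_cases h lty.
have eb : h 0 = (f 0).+1.
  rewrite ey in lty e0; clear -e0 lty hq b0 q0; first_cases h lty.
rewrite ey in S; rewrite x0 in S'; have {}S := same_sym S; have {}S' := same_sym S'.
have a1 : f 0 = 1.
  suff : f 0 <= 1 by lia.
  by apply: (shifted_corner_first_le1 lt2n cf ch cfh eb ep _ urz' S' urz S); rewrite f1 eb.
have {}q1 : bw h 0 = 1.
  suff : bw h 0 <= 1 by lia.
  have Si := same_inv ltq ltz S; rewrite hq in Si.
  have Si' := same_inv lt0n ltz' S'.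
  exact: (@shifted_corner_first_le1 n (inv h) (inv f) (h z') (f z) lt2n (conn_inv ch)
    (conn_inv cf) (covers_inv chf) ep eb q1 (upper_right_inv urz) Si (upper_right_inv urz') Si').
split=> //; rewrite q1 in S.
by apply: (shifted_corner_paths lt2n cf ch _ _ _ _ ltz' S' ltz S); lia.
Qed.

Lemma corner_nonempty_eq n (f h : nperm n) z z' : 2 < n -> conn n f -> conn n h ->
  covers n f h -> covers n h f -> upper_right f z -> upper_right h z' ->
  eqn_on n f h \/ exists e, path_from n f e.
Proof.
move=> lt2n cf ch cfh chf urz urz'.
have [ltab|ltba|E] := ltngtP (f 0) (h 0).
- by right; exists 0; case: (shifted_corner lt2n cf ch cfh chf urz urz' ltab) => _ [].
- by right; exists 1; case: (shifted_corner lt2n ch cf chf cfh urz' urz ltba) => _ [].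
(* Different positions of the minimum would, through the inverses, make the first values differ. *)
have [ltpq|ltqp|E'] := ltngtP (bw f 0) (bw h 0).
- have [] := @shifted_corner n (inv f) (inv h) (f z) (h z') lt2n (conn_inv cf) (conn_inv ch)
    (covers_inv cfh) (covers_inv chf) (upper_right_inv urz) (upper_right_inv urz') ltpq.
  by rewrite /=; lia.
- have [] := @shifted_corner n (inv h) (inv f) (h z') (f z) lt2n (conn_inv ch) (conn_inv cf)
    (covers_inv chf) (covers_inv cfh) (upper_right_inv urz') (upper_right_inv urz) ltqp.
  by rewrite /=; lia.
by left; apply: (equal_corner lt2n cf ch cfh chf E E' urz urz').
Qed.

Theorem reconstruction n (f h : nperm n) : 4 < n -> conn n f -> conn n h ->
  covers n f h -> covers n h f -> eqn_on n f h \/ exists e, path_from n f e.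
Proof.
move=> lt4n cf ch cfh chf; have lt3n : 3 < n by lia.
have [cfi chi] := (conn_inv cf, conn_inv ch).
have [cfhi chfi] := (covers_inv cfh, covers_inv chf).
have max_eq (g g' : nperm n) : conn n g -> conn n g' -> covers n g g' -> covers n g' g ->
    g 0 = n.-1 -> eqn_on n g g'.
  by move=> cg cg' c c' gmax; apply: max_first_eq => //; apply: max_first_transfer gmax.
have [fmax|/eqP fmax] := eqVneq (f 0) n.-1; first by left; apply: max_eq.
have [hmax|/eqP hmax] := eqVneq (h 0) n.-1; first by left; apply/eqn_on_sym/max_eq.
have [fmax'|/eqP fmax'] := eqVneq (bw f 0) n.-1.
  by left; apply/eqn_on_bw/(max_eq (inv f) (inv h)).
have [hmax'|/eqP hmax'] := eqVneq (bw h 0) n.-1.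
  by left; apply/eqn_on_bw/eqn_on_sym/(max_eq (inv h) (inv f)).
have lt1n : 1 < n by lia.
have lt2n : 2 < n by lia.
have [_ _ lta ltp _] := corner_pos cf lt1n; have [_ _ ltb ltq _] := corner_pos ch lt1n.
have dec (g : nperm n) : (exists z, upper_right g z) \/ no_upper_right g.
  have [|/hasPn none] := boolP (has (upper_right g) (iota 0 n)).
    by case/hasP=> z _; left; exists z.
  right=> z; apply/negP => urz; have /none/negP[] // : z \in iota 0 n.
  by rewrite mem_iota; case/andP: urz => /andP[].
case: (dec f) (dec h) => [[z urz]|nf] [[z' urz']|nh].
- exact: (corner_nonempty_eq lt2n cf ch cfh chf urz urz').
- by case: (upper_right_both_empty (f := h) (h := f) lt4n ch cf chf cfh nh _ _ _ _ urz); lia.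
- by case: (upper_right_both_empty lt4n cf ch cfh chf nf _ _ _ _ urz'); lia.
by left; apply: no_upper_right_eq => //; lia.
Qed.

(** * One-line notation *)

Definition perm_fun n (s : 'S_n) (i : nat) : nat :=
  if insub i is Some o then s o else 0.

Lemma perm_funE n (s : 'S_n) (o : 'I_n) : perm_fun s o = s o.
Proof. by rewrite /perm_fun valK. Qed.

Lemma perm_fun_lt n (s : 'S_n) i : i < n -> perm_fun s i < n.
Proof. by move=> lti; rewrite (perm_funE s (Ordinal lti)). Qed.

Lemma perm_funK n (s : 'S_n) i : i < n -> perm_fun s^-1 (perm_fun s i) = i.
Proof. by move=> lti; rewrite (perm_funE s (Ordinal lti)) perm_funE permK. Qed.

Lemma perm_funVK n (s : 'S_n) i : i < n -> perm_fun s (perm_fun s^-1 i) = i.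
Proof. by move=> lti; rewrite (perm_funE s^-1 (Ordinal lti)) perm_funE permKV. Qed.

Definition nperm_of n (s : 'S_n) : nperm n :=
  NPerm (@perm_fun_lt n s) (@perm_fun_lt n s^-1) (@perm_funK n s) (@perm_funVK n s).

Definition ord_fun n (f : nperm n) (i : 'I_n) : 'I_n := Ordinal (fw_lt f (ltn_ord i)).

Lemma ord_fun_inj n (f : nperm n) : injective (ord_fun f).
Proof.
by move=> i j [eqf]; apply: val_inj; rewrite /= -(fwK f (ltn_ord i)) eqf fwK.
Qed.

Definition to_perm n (f : nperm n) : 'S_n := perm (@ord_fun_inj n f).

Lemma to_permK n (f : nperm n) : eqn_on n (perm_fun (to_perm f)) f.
Proof. by move=> i lti; rewrite (perm_funE _ (Ordinal lti)) permE. Qed.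

Definition oneline (pi : permutation) : nperm (perm_length pi) := nperm_of (entry pi).

Lemma one_lineE pi :
  one_line pi = [seq (oneline pi i).+1 | i <- iota 0 (perm_length pi)].
Proof.
rewrite /one_line -val_enum_ord -map_comp; apply: eq_map => i /=.
by rewrite perm_funE.
Qed.

Lemma size_one_line pi : size (one_line pi) = perm_length pi.
Proof. by rewrite one_lineE size_map size_iota. Qed.

Lemma nth_one_line pi i : i < perm_length pi -> nth 0 (one_line pi) i = (oneline pi i).+1.
Proof. by move=> lti; rewrite one_lineE (nth_map 0) ?size_iota // nth_iota. Qed.

Lemma uniq_one_line pi : uniq (one_line pi).
Proof.
rewrite one_lineE map_inj_in_uniq ?iota_uniq // => i j; rewrite !mem_iota => lti ltj [].
exact: (fw_inj (f := oneline pi)).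
Qed.

Lemma mem_one_line pi i : i < perm_length pi -> (oneline pi i).+1 \in one_line pi.
Proof. by move=> lti; rewrite -nth_one_line // mem_nth // size_one_line. Qed.

Lemma size_rem_one_line pi i : i < perm_length pi ->
  size (rem (oneline pi i).+1 (one_line pi)) = (perm_length pi).-1.
Proof. by move=> lti; rewrite size_rem ?mem_one_line // size_one_line. Qed.

Lemma nth_rem_one_line pi i k : i < perm_length pi -> k < (perm_length pi).-1 ->
  nth 0 (rem (oneline pi i).+1 (one_line pi)) k = (oneline pi (bump i k)).+1.
Proof.
move=> lti ltk; have ei : index (oneline pi i).+1 (one_line pi) = i.
  by rewrite -nth_one_line // index_uniq ?size_one_line ?uniq_one_line.
rewrite remE ei nth_cat size_take size_one_line lti.
rewrite -nth_one_line; last by rewrite /bump; lia.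
have [ltki|leik] := ltnP k i; first by rewrite nth_take // /bump leqNgt ltki.
by rewrite nth_drop /bump leik; congr nth; lia.
Qed.

Lemma count_lt_iota m v : v <= m -> count (fun w => w < v) (iota 0 m) = v.
Proof.
move=> lev; rewrite -(subnKC lev) iotaD count_cat add0n.
rewrite (@eq_in_count _ _ predT) ?count_predT ?size_iota; last first.
  by move=> w; rewrite mem_iota => /andP[_ ->].
rewrite (@eq_in_count _ _ pred0) ?count_pred0 ?addn0 // => w.
by rewrite mem_iota => /andP[lew _]; rewrite ltnNge lew.
Qed.

Lemma nperm_rank m (f : nperm m) i : i < m ->
  f i = count (fun j => f j < f i) (iota 0 m).
Proof.
move=> lti; have U : uniq (map f (iota 0 m)).
  rewrite map_inj_in_uniq ?iota_uniq // => j k; rewrite !mem_iota => ltj ltk eqf.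
  exact: fw_inj eqf.
have S : {subset map f (iota 0 m) <= iota 0 m}.
  by move=> _ /mapP[j + ->]; rewrite !mem_iota; apply: fw_lt.
have [|_ E] := uniq_min_size U S; first by rewrite size_map.
have /seq.permP P : perm_eq (map f (iota 0 m)) (iota 0 m).
  by apply: uniq_perm => //; exact: iota_uniq.
rewrite -{1}(count_lt_iota (v := f i) (m := m)); last exact/ltnW/fw_lt.
by rewrite -P count_map.
Qed.

(** A value is the number of entries below it, hence determined by relative order. *)
Lemma same_order_eq m (f g : nperm m) :
  (forall i j, i < m -> j < m -> (f i < f j) = (g i < g j)) -> eqn_on m f g.
Proof.
move=> E i lti; rewrite (nperm_rank f lti) (nperm_rank g lti).
by apply: eq_in_count => j; rewrite mem_iota => ltj; apply: E.
Qed.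

(** * Deletions in one-line notation *)

Lemma deletion_same_length pi i sigma : i < perm_length pi ->
  order_isomorphic (one_line sigma) (rem (oneline pi i).+1 (one_line pi)) ->
  perm_length sigma = (perm_length pi).-1.
Proof. by move=> lti [+ _]; rewrite size_one_line size_rem_one_line. Qed.

Lemma deletionP pi sigma : 0 < perm_length pi ->
  (exists x, is_deletion pi x sigma) <->
  perm_length sigma = (perm_length pi).-1 /\
  exists2 i, i < perm_length pi &
    eqn_on (perm_length pi).-1 (oneline sigma) (del (oneline pi) i).
Proof.
move=> lt0n.
have cmp i k l (lti : i < perm_length pi) : k < (perm_length pi).-1 ->
    l < (perm_length pi).-1 ->
    (nth 0 (rem (oneline pi i).+1 (one_line pi)) k <
     nth 0 (rem (oneline pi i).+1 (one_line pi)) l) =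
    (child (oneline pi) lti k < child (oneline pi) lti l).
  move=> ltk ltl; rewrite !nth_rem_one_line // ltnS.
  rewrite -(@ltn_unbump (oneline pi i)) //;
    by apply: (fw_neq (oneline pi)); rewrite // /bump; lia.
split=> [[x [xin iso]] | [eqlen [i lti E]]].
  have [i lti ex] : exists2 i, i < perm_length pi & x = (oneline pi i).+1.
    have lti : index x (one_line pi) < perm_length pi by rewrite -size_one_line index_mem.
    by exists (index x (one_line pi)); rewrite // -nth_one_line ?nth_index.
  rewrite {x xin}ex in iso.
  have eqlen := deletion_same_length lti iso; split=> //; exists i => //.
  case: iso => _; rewrite size_one_line => iso.
  case: sigma iso eqlen => m s iso /= eqlen; subst m.
  apply: (same_order_eq (f := nperm_of s) (g := child (oneline pi) lti)) => k l ltk ltl.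
  by rewrite -cmp // -iso // !nth_one_line.
exists (oneline pi i).+1; split; first exact: mem_one_line.
split; first by rewrite size_one_line size_rem_one_line.
rewrite size_one_line eqlen => k l ltk ltl.
by rewrite (cmp i k l lti) // !nth_one_line ?eqlen // ltnS !E.
Qed.

(** * Sums and connectedness *)

Lemma conn_sum_indecomposable pi : 0 < perm_length pi ->
  conn (perm_length pi) (oneline pi) -> sum_indecomposable pi.
Proof.
move=> lt0n cpi; split=> // alpha beta lt0a lt0b epi; move: cpi; rewrite {}epi => cpi.
apply: (closed_conn (k := perm_length alpha) cpi); first by rewrite /=; lia.
move=> i lti; rewrite /= (perm_funE _ (lshift (perm_length beta) (Ordinal lti))) permE.
by rewrite /sum_fun (unsplitK (inl (Ordinal lti))) /=.
Qed.

Section SplitSum.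
Variables (k l : nat) (f : nperm (k + l)).
Hypothesis closed : forall i, i < k -> f i < k.

Let closed_inv v : v < k -> bw f v < k.
Proof. by apply: closed_bw closed _; rewrite leq_addr. Qed.

Let ge_lt i : i < l -> f (k + i) - k < l.
Proof.
by move=> lti; have := fw_lt f (i := k + i); have := closed_ge (f := f) (j := k + i) _ closed; lia.
Qed.

Let ge_inv_lt v : v < l -> bw f (k + v) - k < l.
Proof.
move=> ltv; have := bw_lt f (v := k + v).
by have := closed_ge (f := inv f) (j := k + v) _ closed_inv; rewrite /=; lia.
Qed.

Definition lower_part : nperm k.
refine (@NPerm k f (bw f) closed closed_inv _ _).
- by move=> i lti; rewrite fwK // ltn_addr.
- by move=> v ltv; rewrite bwK // ltn_addr.
Defined.

Definition upper_part : nperm l.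
refine (@NPerm l (fun i => f (k + i) - k) (fun v => bw f (k + v) - k) ge_lt ge_inv_lt _ _).
- move=> i lti; rewrite subnKC ?fwK ?addKn ?ltn_add2l //.
  by apply: closed_ge closed; rewrite leq_addr ltn_add2l.
- move=> v ltv; rewrite subnKC ?bwK ?addKn ?ltn_add2l //.
  by apply: (closed_ge (f := inv f)) closed_inv; rewrite leq_addr ltn_add2l.
Defined.

End SplitSum.

Lemma sum_indecomposable_conn pi : sum_indecomposable pi ->
  conn (perm_length pi) (oneline pi).
Proof.
case=> lt0n indec; apply/negPn/negP => /nconn[k ltk ck].
case: pi lt0n indec ltk ck => n s /= lt0n indec ltk ck.
have [l en] : exists l, n = k + l by exists (n - k); lia.
subst n; pose f := nperm_of s.
have cf i : i < k -> f i < k by exact: ck.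
pose alpha := Tagged (fun n => 'S_n) (to_perm (lower_part cf)).
pose beta := Tagged (fun n => 'S_n) (to_perm (upper_part cf)).
case: (indec alpha beta); rewrite /alpha /beta /perm_length /=; try lia.
rewrite /perm_sum /perm_length /entry /=; congr Tagged.
apply/permP => i; rewrite permE /sum_fun; apply: val_inj.
case: (split_ordP i) => j ->; rewrite permE /= -perm_funE //=.
by rewrite subnKC //; apply: (closed_ge (f := f) _ cf); rewrite leq_addr ltn_add2l /=.
Qed.

Lemma path_from_increasing_oscillation pi e : 0 < perm_length pi ->
  path_from (perm_length pi) (oneline pi) e -> increasing_oscillation pi.
Proof.
move=> lt0n [v _ [ltv injv adjv]]; split; first by rewrite card_ord.
have ltc (i : 'I_#|'I_(perm_length pi)|) : i < perm_length pi.
  by have := ltn_ord i; rewrite {2}card_ord.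
exists (fun i : 'I_#|'I_(perm_length pi)| => Ordinal (ltv i (ltc i))) => [|i j].
  apply: inj_card_bij; last by rewrite [X in _ <= X]card_ord.
  by move=> i j [eqv]; apply: val_inj; exact: (injv i j (ltc i) (ltc j) eqv).
rewrite -adjv // /inversion_graph /inverts /=.
by rewrite -!perm_funE /=.
Qed.

Theorem theorem4p2 (pi : permutation) :
  sum_indecomposable pi -> 5 <= perm_length pi -> ~ increasing_oscillation pi ->
  forall tau : permutation, sum_indecomposable tau -> K tau = K pi -> tau = pi.
Proof.
move=> ipi le5 nosc tau itau eqK.
have cpi := sum_indecomposable_conn ipi; have ctau := sum_indecomposable_conn itau.
have lt0n : 0 < perm_length pi by lia.
have lt0m : 0 < perm_length tau by case: itau.
have step (rho rho' : permutation) : sum_indecomposable rho -> sum_indecomposable rho' ->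
    K rho = K rho' -> forall x, 1 < perm_length rho -> x < perm_length rho ->
    noncut (perm_length rho) (oneline rho) x ->
    (perm_length rho).-1 = (perm_length rho').-1 /\
    exists y, [/\ y < perm_length rho', noncut (perm_length rho') (oneline rho') y &
      eqn_on (perm_length rho).-1 (del (oneline rho) x) (del (oneline rho') y)].
  move=> [lt0r ir] [lt0r' ir'] eK x lt1r ltx nc.
  pose sigma : permutation := Tagged (fun n => 'S_n) (to_perm (child (oneline rho) ltx)).
  have Es : eqn_on (perm_length rho).-1 (oneline sigma) (del (oneline rho) x) by exact: to_permK.
  have : K rho sigma.
    split; first by apply/deletionP => //; split=> //; exists x.
    apply: conn_sum_indecomposable; first by change (0 < (perm_length rho).-1); lia.
    by apply: conn_ext nc => i lti; rewrite Es.
  rewrite eK => -[del_s /sum_indecomposable_conn cs].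
  have [eqlen [y lty Ey]] := proj1 (deletionP sigma lt0r') del_s.
  split=> //; exists y; split=> //.
    by rewrite /noncut -eqlen; apply: conn_ext cs => i lti; apply: Ey; rewrite -eqlen.
  by move=> i lti; rewrite -Es // Ey // -eqlen.
(* The first entry or the minimum yields an indecomposable child of [pi], whose length fixes that of
   [tau]. *)
have eqmn : perm_length tau = perm_length pi.
  have lt1n : 1 < perm_length pi by lia.
  case: (first_or_bottom cpi lt0n) => nc.
    by have [] := step pi tau ipi itau (esym eqK) _ lt1n lt0n nc; lia.
  by have [] := step pi tau ipi itau (esym eqK) _ lt1n (bw_lt (oneline pi) lt0n) nc; lia.
case: pi tau ipi itau le5 nosc eqK cpi ctau lt0n lt0m eqmn => n s [m t] ipi itau le5 nosc
  eqK cpi ctau lt0n lt0m eqmn.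
rewrite /perm_length /= in eqmn; subst m.
have lt1n : 1 < n by exact: leq_trans le5.
have cst : covers n (nperm_of s) (nperm_of t).
  move=> x ltx nc; have [_ [y [lty ncy E]]] := step _ _ ipi itau (esym eqK) x lt1n ltx nc.
  by exists y.
have cts : covers n (nperm_of t) (nperm_of s).
  move=> x ltx nc; have [_ [y [lty ncy E]]] := step _ _ itau ipi eqK x lt1n ltx nc.
  by exists y.
case: (reconstruction le5 cpi ctau cst cts) => [E|[e pe]].
  congr Tagged; apply/permP => i; apply: val_inj.
  by rewrite /= -!perm_funE; apply/esym/E.
by case: nosc; exact: path_from_increasing_oscillation pe.
Qed.
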